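(* Let $0<s<\infty$ and let $(X,\mathscr{B},\mu,\rho)$ be a compact Ahlfors $s$-regular probability space. Let $\{\xi_n\}_{n\ge1}$ be a stationary process with values in $X$, defined on a probability space $(\Omega,\mathcal{B},\mathbb{P})$, with probability law $\mu$, and suppose it is exponentially mixing. Let $\{r_n\}_{n\ge1}$ be a sequence of positive real numbers decreasing to $0$, let \[E=\limsup_{n\to\infty}B(\xi_n,r_n),\qquad s_0=\inf\Big\{t\ge0\colon\sum_{n=1}^\infty r_n^t<\infty\Big\},\] and assume $0<s_0\le s$. Then $E\in\mathcal{G}^{s_0}(X)$ almost surely.
   Context: For a metric space $(X,\rho)$, $B(x,r)=\{y\in X:\rho(x,y)<r\}$ and $\overline{B}(x,r)=\{y\in X:\rho(x,y)\le r\}$. $\mathscr{B}$ is the Borel $\sigma$-algebra. A Borel measure $\mu$ is Ahlfors $s$-regular ($0<s<\infty$) if there is $1\le C<\infty$ with $C^{-1}r^s\le\mu(B(x,r))\le Cr^s$ for all $x\in X$ and $0<r\le\operatorname{diam}X$. A compact Ahlfors $s$-regular probability space $(X,\mathscr{B},\mu,\rho)$ means: $(X,\rho)$ is a compact metric space and $\mu$ is an Ahlfors $s$-regular Borel probability measure on it (this is a standing assumption); then $\tau:=\dim_{\rm H}X=s$. For sets $F_n$, $\limsup_{n\to\infty}F_n=\bigcap_{m\ge1}\bigcup_{n\ge m}F_n$. Exponential mixing: $\{\xi_n\}_{n\ge1}$ is exponentially mixing if there exist constants $c>0$ and $0<\gamma<1$ such that for every $n\ge1$, every ball $A\subset X$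 and every $D\in\mathcal{B}_{n+1}$ (with $\mathbb{P}(D)>0$), $|\mathbb{P}(\xi_1\in A\mid D)-\mathbb{P}(\xi_1\in A)|\le c\gamma^n$, where $\mathcal{B}_{n+1}$ is the sub-$\sigma$-field generated by $\{\xi_{n+i}\}_{i\ge1}$. Generalized dyadic cubes: fix $0<b<1/3$ and put $c_1=\frac12-\frac{b}{1-b}$, $c_1'=\frac1{1-b}$. Fix a family of Borel sets $\{Q_{n,i}: n\in\mathbb{Z}, i\in\mathbb{N}_n\subset\mathbb{N}\}$ (which exists by a known theorem) such that: (1) $X=\bigcup_{i\in\mathbb{N}_n}Q_{n,i}$ for every $n$, the sets $Q_{n,i}$ with the same $n$ and distinct $i$ being disjoint; (2) for $n\ge m$, either $Q_{n,i}\cap Q_{m,j}=\varnothing$ or $Q_{n,i}\subset Q_{m,j}$; (3) for each $n,i$ there is $x_{n,i}\in X$ with $B(x_{n,i},c_1b^n)\subset Q_{n,i}\subset\overline{B}(x_{n,i},c_1'b^n)$; (4) there is $x_0\in X$ such that for every $n$ there is $i$ with $B(x_0,c_1b^n)\subset Q_{n,i}$; (5) $\{x_{n,i}\}_{i\in\mathbb{N}_n}\subset\{x_{n+1,i}\}_{i\in\mathbb{N}_{n+1}}$ for all $n$. Put $\mathcal{Q}_0=\{X\}$, $\mathcal{Q}_n=\{Q_{n,i}:i\in\mathbb{N}_n\}$ for $n\ge1$, and $\mathcal{Q}=\bigcup_{n\ge0}\mathcal{Q}_n$. Large intersection classes: for $0<t\le\tau$ and $F\subset X$ let $\mathscr{M}^t_\infty(F)=\inf\{\sum_{i}\mu(Q_i)^{t/\tau}: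 F\subset\bigcup_{i}Q_i,\ Q_i\in\mathcal{Q}\}$ (countable covers). $\mathcal{G}^t(X)$ is the class of all $G_\delta$ sets $F\subset X$ such that for every $0<t'<t$ and every $Q\in\mathcal{Q}$, $\mathscr{M}^{t'}_\infty(F\cap Q)=\mathscr{M}^{t'}_\infty(Q)$. *)

(* Defs.v *)
From HB Require Import structures.
From mathcomp Require Import all_boot all_order all_algebra.
From mathcomp Require Import all_classical all_reals all_analysis.
From mathcomp Require Import borel_hierarchy.

Set Implicit Arguments.
Unset Strict Implicit.
Unset Printing Implicit Defensive.

Import Order.TTheory GRing.Theory Num.Theory.
Import numFieldNormedType.Exports.

Local Open Scope classical_set_scope.
Local Open Scope ring_scope.

(* [measurableType]s are pointed in the library, whereas [metricType]s are
   not.  A space carrying a probability measure is nonempty, so asking for a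
   point is no restriction. *)
#[short(type="pmetricType")]
HB.structure Definition PointedMetric (K : numDomainType) :=
  {M of Pointed M & Metric K M}.

Notation borel X := (g_sigma_algebraType (@open X)).

Section metric_notions.
Context {R : realType} {X : pmetricType R}.

(* The open ball B(x, r) is the library's [ball x r], see [ballEmdist]. *)
Definition cball (x : X) (r : R) : set X := [set y | mdist x y <= r].

(* The added 0 only serves to make the diameter of the empty set 0. *)
Definition diam (A : set X) : \bar R :=
  ereal_sup ([set 0%E] `|` [set (mdist z.1 z.2)%:E | z in A `*` A]).

Definition hausdorff_premeasure (t delta : R) (A : set X) : \bar R :=
  ereal_inf [set (\sum_(0 <= k <oo) (diam (U k)) `^ t)%E
    | U in [set U : (set X)^nat | A `<=` \bigcup_k U k /\
                                  forall k, (diam (U k) <= delta%:E)%E]].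

Definition hausdorff_measure (t : R) (A : set X) : \bar R :=
  ereal_sup [set hausdorff_premeasure t delta A | delta in [set e | 0 < e]].

(* Only exponents t > 0 are used, which avoids the convention about 0 ^ 0 and
   does not change the infimum. *)
Definition hausdorff_dim (A : set X) : \bar R :=
  ereal_inf [set t%:E | t in [set t | 0 < t /\ hausdorff_measure t A = 0%E]].

Definition ahlfors_regular (s : R) (mu : {measure set (borel X) -> \bar R}) :=
  exists2 C : R, 1 <= C & forall (x : X) (r : R),
    0 < r -> (r%:E <= diam [set: X])%E ->
    ((C^-1 * r `^ s)%:E <= mu (ball x r) <= (C * r `^ s)%:E)%E.

(* Generalized dyadic cubes Q n i, with centres x n i, for n in int and
   i in N n (the values at i outside N n are irrelevant). *)
Record dyadic_cubes (b : R) (N : int -> set nat) (Q : int -> nat -> set X)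
    (x : int -> nat -> X) : Prop := DyadicCubes {
  cubes_borel : forall n i, N n i -> measurable (Q n i : set (borel X)) ;
  cubes_cover : forall n, \bigcup_(i in N n) Q n i = [set: X] ;
  cubes_disjoint : forall n i j, N n i -> N n j -> i <> j ->
    Q n i `&` Q n j = set0 ;
  cubes_nested : forall (n m : int) (i j : nat), m <= n -> N n i -> N m j ->
    Q n i `&` Q m j = set0 \/ Q n i `<=` Q m j ;
  cubes_balls : forall n i, N n i ->
    ball (x n i) ((1 / 2 - b / (1 - b)) * b ^ n) `<=` Q n i /\
    Q n i `<=` cball (x n i) (1 / (1 - b) * b ^ n) ;
  cubes_origin : exists x0 : X, forall n, exists2 i, N n i &
    ball x0 ((1 / 2 - b / (1 - b)) * b ^ n) `<=` Q n i ;
  cubes_centers : forall n, x n @` N n `<=` x (n + 1) @` N (n + 1) }.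

(* The union of {X} and of the generations n >= 1. *)
Definition cube_family (N : int -> set nat) (Q : int -> nat -> set X) :
    set (set X) :=
  [set A | A = [set: X] \/ exists (n : int) (i : nat), [/\ 1 <= n, N n i & A = Q n i]].

Section large_intersection.
Variables (mu : {measure set (borel X) -> \bar R}) (QQ : set (set X)).

Let tau : R := fine (hausdorff_dim [set: X]).

(* Countable (finite or infinite, possibly empty) covers are indexed by a set
   of natural numbers. *)
Definition net_content (t : R) (F : set X) : \bar R :=
  ereal_inf [set z | exists (I : set nat) (U : (set X)^nat),
    [/\ forall k, I k -> QQ (U k),
        F `<=` \bigcup_(k in I) U k &
        z = \esum_(k in I) (mu (U k) `^ (t / tau))%E]].

Definition large_intersection (t : R) : set (set X) :=
  [set F | Gdelta F /\ forall t', 0 < t' < t -> forall Q, QQ Q ->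
     net_content t' (F `&` Q) = net_content t' Q].

End large_intersection.
End metric_notions.

Section processes.
Context {R : realType} {d d' : measure_display}.
Context {Omega : measurableType d} {T : measurableType d'}.

(* Processes are indexed from 0: [xi n] stands for the (n+1)-st variable. *)

(* The product sigma-algebra on the sequence space. *)
Definition path_measurable : set (set (nat -> T)) :=
  <<s \bigcup_n preimage_set_system [set: nat -> T] (fun w => w n) measurable >>.

Definition stationary (P : probability Omega R) (xi : nat -> {RV P >-> T}) :=
  forall k (D : set (nat -> T)), path_measurable D ->
    P [set w | D (fun n => xi (n + k)%N w)] = P [set w | D (fun n => xi n w)].

Definition tail_sigma (P : probability Omega R) (xi : nat -> {RV P >-> T})
    (n : nat) : set (set Omega) :=
  <<s \bigcup_(k in [set k | (n <= k)%N])
        preimage_set_system [set: Omega] (xi k) measurable >>.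

Definition cond_prob (P : probability Omega R) (A D : set Omega) : R :=
  fine (P (A `&` D)) / fine (P D).

End processes.

Section mixing.
Context {R : realType} {X : pmetricType R} {d : measure_display}.
Context {Omega : measurableType d}.

(* With indices starting at 0, [tail_sigma xi n] is generated by the variables
   of (one-based) index at least n + 1. *)
Definition exponentially_mixing (P : probability Omega R)
    (xi : nat -> {RV P >-> borel X}) :=
  exists c gamma : R, [/\ 0 < c, 0 < gamma < 1 &
    forall (n : nat) (x : X) (r : R) (D : set Omega),
      (1 <= n)%N -> 0 < r -> tail_sigma xi n D -> (0 < P D)%E ->
      `| cond_prob P (xi 0%N @^-1` ball x r) D
         - fine (P (xi 0%N @^-1` ball x r)) | <= c * gamma ^+ n].

End mixing.

Definition convergence_exponent {R : realType} (r : R^nat) : \bar R :=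
  ereal_inf [set t%:E | t in
    [set t : R | 0 <= t /\ (\sum_(0 <= n <oo) (r n `^ t)%:E < +oo)%E]].

(* Main.v *)
Require Import Defs.
From mathcomp Require Import all_boot all_order all_algebra.
From mathcomp Require Import all_classical all_reals all_analysis.
From mathcomp Require Import borel_hierarchy.
From mathcomp Require Import lra ring.

Set Implicit Arguments.
Unset Strict Implicit.
Unset Printing Implicit Defensive.

Import Order.TTheory GRing.Theory Num.Theory.
Import numFieldNormedType.Exports.

Local Open Scope classical_set_scope.
Local Open Scope ring_scope.

(** The dimension of X is s, so the exponent in the net content is theta = t / s,
    and a single cube A shows that its content is at most mu(A)^theta. What has
    to be proved is that, almost surely, for all 0 < t < s0 and every cube A,
    a family of cubes U_k that covers the part of the limsup set in A satisfies
    sum_k mu(U_k)^theta >= mu(A)^theta.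

    Deterministic part ([limsup_cover_ge]). Suppose the sum is too small, and
    call a cube light when the U_k meeting it have a sum below the theta-power
    of its measure. Since theta < 1, the U_k inside a light cube A leave a
    definite part of its measure uncovered, so for large m a definite fraction
    of the subcubes of generation m lies in no U_k; there are about b^(-m s) of
    them. If each contains near its centre some xi_n with r_n >= h^m, it
    contains a smaller cube inside B(xi_n, r_n) of measure about h^(m s). If all
    these small cubes were heavy, the cover sum would be at least about
    b^(-m s) h^(m t), which is unbounded when b^s < h^t. So one of them is light,
    and it comes with a closed set between it and A. Iterating, a nested
    sequence of light cubes shrinks to a point of the limsup set that no U_k
    can contain. The boundaries of the cubes need no attention because the
    counting leaves so much room.

    Probabilistic part ([ae_hits_cubes]). By stationarity and mixing, visits of
    a ball at times spaced by a multiple of m behave like independent trials up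
    to an error below b^(m s). Hence, almost surely, for all large m every cube
    of generation m is visited before time about m B^m, where B > b^(-s)
    ([ae_visits_cubes], by Borel-Cantelli). Since the series of the r_n^t2
    diverges for t2 < s0, the radius at that time exceeds h^m for infinitely
    many m when B h^t2 < 1 ([frequently_ge]). For t < t2 < s0 some h meets both
    constraints.

    The condition on h becomes weaker as t decreases, so a sequence of
    exponents increasing to s0 gives one almost sure event for all t. *)


(** * Sums over sets of indices *)

Section esum_extra.
Context {R : realType}.
Local Open Scope ereal_scope.

Lemma ge0_esumZl (I : set nat) (a : nat -> \bar R) (c : R) :
  (0 <= c)%R -> (forall i, 0 <= a i) ->
  \esum_(i in I) (c%:E * a i) = c%:E * \esum_(i in I) a i.
Proof.
move=> c0 a0; rewrite esum_mkcond [in RHS]esum_mkcond.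
rewrite -!nneseries_esumT.
- rewrite -nneseriesZl; last by move=> n _; case: ifP.
  by apply: eq_eseriesr => n _; case: ifP => // _; rewrite mule0.
- by move=> n; case: ifP.
- by move=> n; case: ifP => // _; rewrite mule_ge0// lee_fin.
Qed.

Lemma le_esum_set (T : choiceType) (I J : set T) (a : T -> \bar R) :
  I `<=` J -> (forall i, 0 <= a i) ->
  \esum_(i in I) a i <= \esum_(i in J) a i.
Proof.
move=> IJ a0; rewrite esum_mkcond [leRHS]esum_mkcond; apply: le_esum => i _.
case: ifPn => [/set_mem/IJ/mem_set ->//|_]; by case: ifP.
Qed.

Lemma esum_ge_term (T : choiceType) (I : set T) (a : T -> \bar R) i :
  I i -> (forall i, 0 <= a i) -> a i <= \esum_(i in I) a i.
Proof.
move=> Ii a0; rewrite -[leLHS](@esum_set1 _ _ i a (a0 i)); apply: le_esum_set => //.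
by move=> _ ->.
Qed.

Lemma esum_disjoint_le (J : set nat) (S : nat -> set nat)
    (T : set nat) (a : nat -> \bar R) :
  trivIset J S -> (forall i, J i -> S i `<=` T) -> (forall k, 0 <= a k)%E ->
  \esum_(i in J) \esum_(k in S i) a k <= \esum_(k in T) a k.
Proof.
move=> tS ST a0; pose S' i := if i \in J then S i else set0.
rewrite (eq_esum (b := fun i => \esum_(k in S' i) a k)); last first.
  by move=> i Ji; rewrite /S' mem_set.
rewrite -esum_bigcup//.
- apply: le_esum_set => // k [i Ji]; rewrite /S' mem_set//; exact: ST.
- move=> i j _ _ [k []]; rewrite /S'.
  case: ifPn => [/set_mem Ji|//]; case: ifPn => [/set_mem Jj|//] Si Sj.
  by apply: tS => //; exists k.
Qed.

Lemma measure_le_esum d (T : measurableType d) (mu : {measure set T -> \bar R})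
    (I : set nat) (F : nat -> set T) (A : set T) :
  measurable A -> (forall i, I i -> measurable (F i)) ->
  A `<=` \bigcup_(i in I) F i -> mu A <= \esum_(i in I) mu (F i).
Proof.
move=> mA mF AF; rewrite esum_mkcond -nneseries_esumT; last first.
  by move=> n; case: ifP.
pose G i := if i \in I then F i else set0.
rewrite (eq_eseriesr (g := mu \o G)); last first.
  by move=> i _; rewrite /G/=; case: ifP => //; rewrite measure0.
apply: (@measure_sigma_subadditive _ _ _ mu) => //.
- by move=> n; rewrite /G; case: ifPn => // /set_mem; exact: mF.
- move=> x /AF[i Ii Fx]; exists i => //; by rewrite /G mem_set.
Qed.

End esum_extra.

Section geometric_sequences.
Context {R : realType}.

Lemma nneseries_geometric_lty (z : R) : 0 <= z < 1 ->
  (\sum_(0 <= n <oo) (z ^+ n)%:E < +oo)%E.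
Proof.
move=> /andP[z0 z1].
apply: (@le_lt_trans _ _ ((1 - z)^-1)%:E); last exact: ltry.
apply: lime_le; first by apply: is_cvg_nneseries => n _ _; rewrite lee_fin exprn_ge0.
apply: nearW => n; rewrite sumEFin lee_fin.
have := @geometric_seriesE R 1 z; rewrite lt_eqF// => /(_ isT).
move=> /(congr1 (fun f => f n)) /=; rewrite /series/= /geometric/=.
under eq_bigr do rewrite mul1r. move=> ->.
by rewrite mul1r ler_piMl ?invr_ge0 ?subr_ge0 ?(ltW z1)// gerBl exprn_ge0.
Qed.

Lemma expr_small (z e : R) : 0 <= z < 1 -> 0 < e -> exists M,
  forall n, (M <= n)%N -> z ^+ n < e.
Proof.
move=> /andP[z0 z1] e0.
have : z ^+ n @[n --> \oo] --> (0:R) by apply: cvg_expr; rewrite ger0_norm.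
move=> /cvgrPdist_lt/(_ _ e0)[M _ HM]; exists M => n Mn.
by have := HM n Mn; rewrite /= sub0r normrN ger0_norm// exprn_ge0.
Qed.

Lemma powR_exprn (a s : R) m : 0 <= a ->
  (a ^+ m) `^ s = (a `^ s) ^+ m.
Proof. by move=> a0; rewrite -[a ^+ m]powR_mulrn// powRAC powR_mulrn// powR_ge0. Qed.

End geometric_sequences.

(** * Balls and Ahlfors regularity *)

Section balls.
Context {R : realType} {X : pmetricType R}.
Implicit Types (x y : X) (r : R).

Lemma open_mball x r : open (ball x r).
Proof.
rewrite openE => y; rewrite ballEmdist/= => yx.
apply/nbhs_ballP; exists (r - mdist x y) => /=; first by rewrite subr_gt0.
move=> z; rewrite !ballEmdist/= => yz.
by rewrite (le_lt_trans (metric_triangle x y z))// -ltrBrDl.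
Qed.

Lemma closed_cball x r : closed (cball x r).
Proof.
rewrite -openC openE => y /= /negP; rewrite -ltNge => yx.
apply/nbhs_ballP; exists (mdist x y - r) => /=; first by rewrite subr_gt0.
move=> z; rewrite ballEmdist/= => yz xz.
rewrite /cball/= in xz; have := metric_triangle x z y.
by rewrite (metric_sym z y); lra.
Qed.

Lemma measurable_mball x r : measurable (ball x r : set (borel X)).
Proof. by apply: sub_sigma_algebra; exact: open_mball. Qed.

Lemma measurable_cball x r : measurable (cball x r : set (borel X)).
Proof.
rewrite -[cball x r]setCK; apply: measurableC; apply: sub_sigma_algebra.
by rewrite openC; exact: closed_cball.
Qed.

Lemma cball_sub_ball x r1 r2 : r1 < r2 -> cball x r1 `<=` ball x r2.
Proof. by move=> r12 y /= h; rewrite ballEmdist/= (le_lt_trans h). Qed.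

Lemma cball_sub_triangle x y r1 r2 : cball x r1 y -> cball x r1 `<=` cball y (r1 + r1).
Proof.
rewrite /cball/= => xy z /= xz; rewrite (le_trans (metric_triangle y x z))//.
by rewrite (metric_sym y) lerD.
Qed.

End balls.

Section ahlfors.
Context {R : realType} {X : pmetricType R} {mu : probability (borel X) R}.
Variable s : R.
Hypotheses (s_gt0 : 0 < s) (mu_reg : ahlfors_regular s mu).
Hypothesis diam_gt0 : (0 < diam [set: X])%E.

(** Regularity only speaks of radii up to the diameter; shrinking a radius
    r <= 1 by a fixed factor brings it into that range. *)
Lemma ahlfors_lower : exists2 c : R, 0 < c &
  forall x r, 0 < r <= 1 -> ((c * r `^ s)%:E <= mu (ball x r))%E.
Proof.
have [C C1 HC] := mu_reg; have C0 : 0 < C by rewrite (lt_le_trans _ C1).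
have [D [D0 D1 DX]] : exists D, [/\ 0 < D, D <= 1 & (D%:E <= diam [set: X])%E].
  move: diam_gt0; case: (diam _) => [D| |]//.
    rewrite lte_fin => D0; exists (Num.min D 1); rewrite lt_min D0 ltr01 ge_min.
    by rewrite lexx orbT lee_fin ge_min lexx.
  by exists 1; rewrite leey.
exists (C^-1 * D `^ s); first by rewrite mulr_gt0// ?invr_gt0// powR_gt0.
move=> x r /andP[r0 r1]; have rD0 : 0 < D * r by rewrite mulr_gt0.
have rD : ((D * r)%:E <= D%:E)%E by rewrite lee_fin ger_pMr.
have /andP[h _] := HC x _ rD0 (le_trans rD DX).
rewrite -mulrA -powRM ?(ltW D0) ?(ltW r0)//; apply: (le_trans h).
apply: le_measure; rewrite ?inE; try exact: measurable_mball.
by apply: le_ball; rewrite ger_pMl.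
Qed.

(** Beyond the diameter the bound holds because mu has total mass 1. Closed
    balls of radius 0 are included, so that points are null sets. *)
Lemma ahlfors_upper : exists2 C : R, 0 < C &
  forall x r, 0 <= r -> (mu (cball x r) <= (C * r `^ s)%:E)%E.
Proof.
have [C C1 HC] := mu_reg; have C0 : 0 < C by rewrite (lt_le_trans _ C1).
have [D [D0 DX]] : exists D, [/\ 0 < D & (D%:E <= diam [set: X])%E].
  move: diam_gt0; case: (diam _) => [D| |]//; first by exists D; rewrite lexx.
  by exists 1; rewrite leey.
pose K := Num.max C (D^-1 `^ s).
have K0 : 0 < K by rewrite lt_max C0.
have upper x r : 0 < r -> (mu (ball x r) <= (K * r `^ s)%:E)%E.
  move=> r0; have [rD|Dr] := leP r D.
    have rDE : (r%:E <= D%:E)%E by rewrite lee_fin.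
    have /andP[_ h] := HC x _ r0 (le_trans rDE DX); apply: (le_trans h).
    by rewrite lee_fin ler_wpM2r ?powR_ge0// le_max lexx.
  apply: (le_trans (probability_le1 _ _)); first exact: measurable_mball.
  rewrite lee_fin (@le_trans _ _ (D^-1 `^ s * r `^ s))//.
    rewrite -powRM ?invr_ge0 ?(ltW D0) ?(ltW r0)//.
    rewrite [leLHS](_ : _ = 1 `^ s); last by rewrite powR1.
    rewrite ge0_ler_powR ?nnegrE ?(ltW s_gt0)// ?mulr_ge0 ?invr_ge0
      ?(ltW D0) ?(ltW r0)//.
    by rewrite mulrC ler_pdivlMr// mul1r ltW.
  by rewrite ler_wpM2r ?powR_ge0// le_max lexx orbT.
exists (K * 2 `^ s); first by rewrite mulr_gt0// powR_gt0.
move=> x r; rewrite le_eqVlt => /predU1P[<-|r0].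
  (* letting the radius of a larger ball tend to 0 *)
  rewrite powR0 ?gt_eqF// mulr0; apply/lee_addgt0Pr => e e0; rewrite add0e.
  pose q := (e / K) `^ s^-1.
  have q0 : 0 < q by apply: powR_gt0; rewrite divr_gt0.
  apply: (@le_trans _ _ (mu (ball x q))).
    apply: le_measure; rewrite ?inE; [exact: measurable_cball|exact: measurable_mball|].
    exact: cball_sub_ball.
  apply: (le_trans (upper _ _ q0)); rewrite lee_fin /q -powRrM mulVf ?gt_eqF//.
  by rewrite powRr1 ?divr_ge0 ?(ltW e0) ?(ltW K0)// mulrC divfK ?gt_eqF.
apply: (@le_trans _ _ (mu (ball x (2 * r)))).
  apply: le_measure; rewrite ?inE; [exact: measurable_cball|exact: measurable_mball|].
  by apply: cball_sub_ball; lra.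
by apply: (le_trans (upper _ _ _)); rewrite ?mulr_gt0// -mulrA -powRM// (ltW r0).
Qed.

End ahlfors.

(** * Generalized dyadic cubes *)

Section cube_family.
Context {R : realType} {X : pmetricType R}.
Variables (b : R) (N : int -> set nat) (Q : int -> nat -> set X).
Variable x : int -> nat -> X.
Hypotheses (hb : 0 < b < 1 / 3) (hQ : dyadic_cubes b N Q x).

Lemma inner_radius_gt0 : 0 < 1 / 2 - b / (1 - b).
Proof.
have /andP[b0 b3] := hb; have b1 : 0 < 1 - b by lra.
rewrite subr_gt0 ltr_pdivrMr//; lra.
Qed.

Lemma inner_radius_lt1 : 1 / 2 - b / (1 - b) < 1.
Proof.
have /andP[b0 b3] := hb; have b1 : 0 < 1 - b by lra.
by have : 0 < b / (1 - b) by [rewrite divr_gt0|]; lra.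
Qed.

Lemma outer_radius_gt1 : 1 < 1 / (1 - b).
Proof.
have /andP[b0 b3] := hb; have b1 : 0 < 1 - b by lra.
by rewrite ltr_pdivlMr//; lra.
Qed.

Lemma cube_at (m : nat) (y : X) : exists2 i, N m i & Q m i y.
Proof.
have : [set: X] y by []. by rewrite -(cubes_cover hQ m) => -[i Ni Qy]; exists i.
Qed.

Lemma cube_sub_cball (m : nat) i y : N m i -> Q m i y ->
  Q m i `<=` cball y (2 / (1 - b) * b ^+ m).
Proof.
move=> Ni Qy; have [_ sub] := cubes_balls hQ Ni.
have -> : 2 / (1 - b) * b ^+ m =
          1 / (1 - b) * b ^+ m + 1 / (1 - b) * b ^+ m by ring.
by apply: (subset_trans sub) => z; move: (sub _ Qy) => /cball_sub_triangle; apply.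
Qed.

Lemma ball_sub_cube (m : nat) i : N m i ->
  ball (x m i) ((1 / 2 - b / (1 - b)) * b ^+ m) `<=` Q m i.
Proof. by move=> /(cubes_balls hQ)[]. Qed.

Lemma cube_family_measurable A : cube_family N Q A ->
  measurable (A : set (borel X)).
Proof.
move=> [->|[n [i [_ Ni ->]]]]; first exact: measurableT.
exact: (cubes_borel hQ Ni).
Qed.

Lemma cube_family_cube (m : nat) i : (0 < m)%N -> N m i ->
  cube_family N Q (Q m i).
Proof. by move=> m0 Ni; right; exists m, i; split=> //; rewrite lez_nat. Qed.

Lemma cube_family_nested A B : cube_family N Q A -> cube_family N Q B ->
  [\/ A `&` B = set0, A `<=` B | B `<=` A].
Proof.
move=> [->|[n [i [n1 Ni ->]]]] [->|[m [j [m1 Nj ->]]]];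
  [by apply: Or32|by apply: Or33|by apply: Or32|].
have [mn|/ltW nm] := leP m n.
  by have [|] := cubes_nested hQ mn Ni Nj; [exact: Or31|exact: Or32].
have [|] := cubes_nested hQ nm Nj Ni; last exact: Or33.
by rewrite setIC; exact: Or31.
Qed.

(** The space itself belongs to the family without being tied to a generation,
    hence the uniform treatment through a threshold m0. *)
Lemma cube_family_refine A : cube_family N Q A ->
  exists m0, forall m, (m0 <= m)%N -> forall y, A y ->
    exists i, [/\ N m i, Q m i y & Q m i `<=` A].
Proof.
move=> [->|[n [i [n1 Ni ->]]]].
  by exists 0%N => m _ y _; have [j Nj Qj] := cube_at m y; exists j.
case: n n1 Ni => // n _ Ni; exists n => m nm y Qy.
have [j Nj Qj] := cube_at m y; exists j; split => //.
have nmZ : n%:Z <= m by rewrite lez_nat.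
have [|//] := cubes_nested hQ nmZ Nj Ni.
by move=> /seteqP[/(_ y) h _]; case: h.
Qed.

Section cube_measure.
Context {mu : probability (borel X) R}.
Variable s : R.
Hypotheses (s_gt0 : 0 < s) (mu_reg : ahlfors_regular s mu).
Hypothesis diam_gt0 : (0 < diam [set: X])%E.

Let b_gt0 : 0 < b. Proof. by case/andP: hb. Qed.
Let b_lt1 : b < 1. Proof. by case/andP: hb; lra. Qed.

(** Half of the inner radius leaves room for a small ball, around any point
    of the halved ball, to stay inside the cube. *)
Lemma inner_ball_measure_ge : exists2 c : R, 0 < c & forall (m : nat) i,
  ((c * (b `^ s) ^+ m)%:E <=
   mu (ball (x m i) ((1 / 2 - b / (1 - b)) / 2 * b ^+ m)))%E.
Proof.
have [c c0 hc] := ahlfors_lower mu_reg diam_gt0.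
have i0 := inner_radius_gt0; have i1 := inner_radius_lt1.
have bm0 m : 0 < b ^+ m by rewrite exprn_gt0.
have bm1 m : b ^+ m <= 1 by rewrite exprn_ile1// ltW.
set e := (_ / 2); have e0 : 0 < e by rewrite divr_gt0.
have e1 : e <= 1 by rewrite /e; lra.
exists (c * e `^ s) => [|m i]; first by rewrite mulr_gt0// powR_gt0.
have -> : c * e `^ s * (b `^ s) ^+ m = c * (e * b ^+ m) `^ s.
  by rewrite [in RHS]powRM ?(ltW e0) ?(ltW (bm0 m))// powR_exprn ?(ltW b_gt0)// mulrA.
by apply: hc; rewrite mulr_gt0//= mulr_ile1// ltW.
Qed.

Lemma cube_measure_ge : exists2 c : R, 0 < c & forall (m : nat) i,
  N m i -> ((c * (b `^ s) ^+ m)%:E <= mu (Q m i))%E.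
Proof.
have [c c0 hc] := inner_ball_measure_ge; exists c => // m i Ni.
apply: (le_trans (hc m i)); apply: le_measure; rewrite ?inE.
- exact: measurable_mball.
- exact: (cubes_borel hQ Ni).
- apply: subset_trans (ball_sub_cube Ni); apply: le_ball.
  have bm0 : 0 < b ^+ m by rewrite exprn_gt0.
  by have i0 := inner_radius_gt0; rewrite ler_pM2r//; lra.
Qed.

Lemma cube_measure_le : exists2 C : R, 0 < C & forall (m : nat) i,
  N m i -> (mu (Q m i) <= (C * (b `^ s) ^+ m)%:E)%E.
Proof.
have [C C0 hC] := ahlfors_upper s_gt0 mu_reg diam_gt0.
have o1 := outer_radius_gt1; have o0 : 0 < 1 / (1 - b) by lra.
have bm0 m : 0 < b ^+ m by rewrite exprn_gt0.
exists (C * (1 / (1 - b)) `^ s) => [|m i Ni].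
  by rewrite mulr_gt0// powR_gt0.
have -> : C * (1 / (1 - b)) `^ s * (b `^ s) ^+ m =
          C * (1 / (1 - b) * b ^+ m) `^ s.
  by rewrite [in RHS]powRM ?(ltW o0) ?(ltW (bm0 m))// powR_exprn ?(ltW b_gt0)// mulrA.
have [_ sub] := cubes_balls hQ Ni.
apply: (le_trans _ (hC (x m i) _ _)); last by rewrite mulr_ge0// ltW.
by apply: le_measure; rewrite ?inE;
  [exact: (cubes_borel hQ Ni)|exact: measurable_cball|].
Qed.

Lemma cube_family_measure_gt0 A : cube_family N Q A -> (0 < mu A)%E.
Proof.
move=> [->|[n [i [n1 Ni ->]]]]; first by rewrite probability_setT lte01.
case: n n1 Ni => // n _ Ni; have [c c0 hc] := cube_measure_ge.
apply: lt_le_trans (hc _ _ Ni); rewrite lte_fin mulr_gt0// exprn_gt0//.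
exact: powR_gt0.
Qed.

(** The radii of the balls are unrelated to the powers of b; this fits cubes
    into them at the cost of a constant factor in the measure. *)
Lemma cube_of_scale : exists2 c : R, 0 < c & forall y r, 0 < r <= 1 ->
  exists A, [/\ cube_family N Q A, A y, A `<=` cball y r &
                ((c * r `^ s)%:E <= mu A)%E].
Proof.
have [c c0 hc] := cube_measure_ge.
have o1 := outer_radius_gt1; set o := 2 / (1 - b).
have o2 : 2 < o by rewrite (_ : o = 2 * (1 / (1 - b))); [lra|rewrite /o; ring].
have o0 : 0 < o by lra.
have bm0 m : 0 < b ^+ m by rewrite exprn_gt0.
exists (c * (b / o) `^ s) => [|y r /andP[r0 r1]].
  by rewrite mulr_gt0// powR_gt0// divr_gt0.
have [M hM] : exists M, forall n, (M <= n)%N -> b ^+ n < r / o.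
  by apply: expr_small; [rewrite (ltW b_gt0)|rewrite divr_gt0].
have exm : exists m, o * b ^+ m <= r.
  by exists M; rewrite mulrC -ler_pdivlMr// ltW// hM.
(* the first generation whose cubes fit into the ball; the previous one
   being too large bounds b ^ m from below *)
pose m := ex_minn exm; have [hm minm] : o * b ^+ m <= r /\
    forall n, o * b ^+ n <= r -> (m <= n)%N by rewrite /m; case: ex_minnP.
have m0 : (0 < m)%N.
  by rewrite lt0n; apply/eqP => m0; move: hm; rewrite m0 expr0; lra.
have hm1 : r < o * b ^+ m.-1.
  by rewrite ltNge; apply/negP => /minm; rewrite leqNgt prednK// leqnn.
have [i Ni Qi] := cube_at m y; exists (Q m i); split => //.
- exact: cube_family_cube.
- apply: (subset_trans (cube_sub_cball Ni Qi)) => z; rewrite /cball/=.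
  by move=> /le_trans; apply.
- apply: le_trans (hc _ _ Ni); rewrite lee_fin -mulrA ler_pM2l//.
  have ro : 0 <= b / o by rewrite divr_ge0// ltW.
  rewrite -powR_exprn ?(ltW b_gt0)// -powRM ?(ltW r0)//.
  rewrite ge0_ler_powR ?nnegrE ?(ltW s_gt0) ?(ltW (bm0 m)) ?mulr_ge0
    ?invr_ge0 ?(ltW r0) ?(ltW b_gt0) ?(ltW o0)//.
  by rewrite mulrAC ler_pdivrMr// -(prednK m0) exprS -mulrA ler_pM2l// mulrC ltW.
Qed.

End cube_measure.
End cube_family.

(** * Covers of a limsup set *)

Section limsup_covers.
Context {R : realType} {X : pmetricType R}.
Variables (b : R) (N : int -> set nat) (Q : int -> nat -> set X).
Variable x : int -> nat -> X.

(** At arbitrarily small scales b^m, each cube of generation m is visited near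
    its centre by a late y n whose ball has a radius as large as h^m.  This is
    all that the argument below uses about the sequence y. *)
Definition hits_cubes (y : nat -> X) (r : R^nat) (h : R) :=
  forall M, exists2 m, (M <= m)%N & forall i, N m i -> exists n,
    [/\ (M <= n)%N,
        ball (x m i) ((1 / 2 - b / (1 - b)) / 2 * b ^+ m) (y n) &
        h ^+ m <= r n].

Context {mu : probability (borel X) R}.
Hypotheses (hb : 0 < b < 1 / 3) (hQ : dyadic_cubes b N Q x).
Variable s : R.
Hypotheses (s_gt0 : 0 < s) (mu_reg : ahlfors_regular s mu).
Hypothesis diam_gt0 : (0 < diam [set: X])%E.
Hypothesis hX : compact [set: X].
Variables (y : nat -> X) (r : R^nat) (h t : R).
Hypotheses (h_gt0 : 0 < h) (h_leb : h <= b) (h_t : b `^ s < h `^ t).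
Hypotheses (t_gt0 : 0 < t) (t_lts : t < s).
Hypothesis hit : hits_cubes y r h.
Variables (I : set nat) (U : (set X)^nat).
Hypothesis cubeU : forall k, I k -> cube_family N Q (U k).

Let theta := t / s.
Let b_gt0 : 0 < b. Proof. by case/andP: hb. Qed.
Let b_lt1 : b < 1. Proof. by case/andP: hb; lra. Qed.
Let h_lt1 : h < 1. Proof. exact: le_lt_trans h_leb b_lt1. Qed.
Let theta_gt0 : 0 < theta. Proof. by rewrite divr_gt0. Qed.
Let theta_lt1 : theta < 1. Proof. by rewrite ltr_pdivrMr// mul1r. Qed.

Let w k := (mu (U k) `^ theta)%E.
Let w_ge0 k : (0 <= w k)%E. Proof. exact: poweR_ge0. Qed.

(** For a cube A, the members of the cover that meet A carry the sum [load A];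
    A is light when this sum is too small for a cover of A. Lightness is the
    property propagated along a nested sequence of cubes. *)
Let meets (A : set X) : set nat := I `&` [set k | U k `&` A !=set0].
Let load A := (\esum_(k in meets A) w k)%E.
Let light A := (load A < mu A `^ theta)%E.

Let meets_sub A B : A `<=` B -> meets A `<=` meets B.
Proof.
by move=> AB k [Ik [z [Uz Az]]]; split=> //; exists z; split=> //; exact: AB.
Qed.

Let load_le A B : A `<=` B -> (load A <= load B)%E.
Proof. by move=> AB; apply: le_esum_set => //; exact: meets_sub. Qed.

(** A member containing A would alone make the load at least mu(A)^theta. *)
Let light_sub A k : cube_family N Q A -> light A -> I k ->
  U k `&` A !=set0 -> U k `<=` A.
Proof.
move=> cA lA Ik UA; have [UA0|//|AU] := cube_family_nested hQ (cubeU Ik) cA.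
  by move: UA => -[z]; rewrite UA0.
move: lA; rewrite /light ltNge => /negP[]; apply: (@le_trans _ _ (w k)).
  apply: gt0_ler_poweR; rewrite ?(ltW theta_gt0)// ?in_itv/= ?measure_ge0 ?leey//.
  by apply: le_measure; rewrite ?inE//;
    [exact: (cube_family_measurable hQ cA)|
     exact: (cube_family_measurable hQ (cubeU Ik))].
exact: esum_ge_term.
Qed.

Let mu_fin A : cube_family N Q A -> mu A = (fine (mu A))%:E.
Proof.
move=> cA; rewrite fineK//; apply: fin_num_measure.
exact: (cube_family_measurable hQ cA).
Qed.

(** As theta < 1 and every mu(U k) is at most mu(A), replacing the exponent
    theta by 1 costs the factor mu(A)^(1 - theta). The right-hand side is less
    than mu(A) for a light A: a definite part of A is left uncovered. *)
Let mu_covered_le A : cube_family N Q A -> light A ->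
  (\esum_(k in meets A) mu (U k) <=
   (fine (mu A) `^ (1 - theta))%:E * load A)%E.
Proof.
move=> cA lA; rewrite -ge0_esumZl ?powR_ge0//.
apply: le_esum => k [Ik UA]; have UsubA := light_sub cA lA Ik UA.
have U0 := cube_family_measure_gt0 hb hQ mu_reg diam_gt0 (cubeU Ik).
have : (mu (U k) <= mu A)%E.
  by apply: le_measure; rewrite ?inE//;
    [exact: (cube_family_measurable hQ (cubeU Ik))|
     exact: (cube_family_measurable hQ cA)].
rewrite /w (mu_fin (cubeU Ik)) (mu_fin cA) poweR_EFin -EFinM !lee_fin /=.
move: U0; rewrite (mu_fin (cubeU Ik)) lte_fin.
set u := fine _ => u0; set a := fine _ => ua.
rewrite -[leLHS](@powRr1 _ u (ltW u0)) -[in leLHS](subrK theta 1).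
rewrite powRD ?subrK ?oner_eq0// ler_pM2r ?powR_gt0//.
by rewrite ge0_ler_powR ?nnegrE ?subr_ge0 ?(ltW theta_lt1) ?(ltW u0)
  ?(le_trans (ltW u0) ua).
Qed.

(** If every small cube contained in a ball B(y n, r n) near the centre of a
    subcube of generation m were heavy, then each subcube that lies in no U k
    would have a load at least wm, of order (h^t)^m. Its measure, of order
    (b^s)^m, is much smaller than wm. As the loads of different subcubes come
    from disjoint parts of the cover, the total measure of the subcubes would be
    negligible against the load of A, contradicting the definite uncovered part
    of A. *)
Let light_step A M (e : R) : cube_family N Q A -> light A -> 0 < e ->
  exists n F A', [/\ (M <= n)%N, closed F, F `<=` A, F `<=` ball (y n) (r n) &
    [/\ cube_family N Q A', A' `<=` F, light A' & (mu A' < e%:E)%E]].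
Proof.
move=> cA lA e0.
have [K K0 muQ] := cube_measure_le hb hQ s_gt0 mu_reg diam_gt0.
have [c c0 scale] := cube_of_scale hb hQ s_gt0 mu_reg diam_gt0.
have [C C0 muB] := ahlfors_upper s_gt0 mu_reg diam_gt0.
have [m0 refine] := cube_family_refine hQ cA.
have i0 := inner_radius_gt0 hb; have i1 := inner_radius_lt1 hb.
set i_ := (1 / 2 - b / (1 - b)) in i0 i1.
pose q := b `^ s; have h_q : q < h `^ t by []; have q0 : 0 < q by exact: powR_gt0.
have ht0 : 0 < h `^ t by exact: powR_gt0.
have loadA_fin : load A = (fine (load A))%:E.
  rewrite fineK// ge0_fin_numE; last exact: esum_ge0.
  by rewrite (lt_le_trans lA)// (mu_fin cA) poweR_EFin leey.
set a := fine (mu A); set v := fine (load A) in loadA_fin.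
have a0 : 0 < a.
  by have := cube_family_measure_gt0 hb hQ mu_reg diam_gt0 cA; rewrite (mu_fin cA).
have v0 : 0 <= v by rewrite fine_ge0// esum_ge0.
have va : v < a `^ theta.
  by move: (lA); rewrite /light loadA_fin (mu_fin cA) poweR_EFin lte_fin.
pose gap := a - a `^ (1 - theta) * v.
have gap0 : 0 < gap.
  rewrite subr_gt0 -[ltRHS](@powRr1 _ a (ltW a0)) -[in ltRHS](subrK theta 1).
  by rewrite [in ltRHS]powRD ?subrK ?oner_eq0// ltr_pM2l// powR_gt0.
pose la := c `^ theta * (i_ / 4) `^ t.
have la0 : 0 < la by rewrite mulr_gt0// powR_gt0// divr_gt0.
have [m1 hm1] : exists m1, forall m, (m1 <= m)%N ->
    (q / h `^ t) ^+ m < gap * la / (K * (v + 1)).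
  apply: expr_small; first by rewrite divr_ge0 ?ltW//= ltr_pdivrMr// mul1r.
  by rewrite divr_gt0// mulr_gt0// ltr_wpDl.
have [m2 hm2] : exists m2, forall m, (m2 <= m)%N -> (h `^ s) ^+ m < e / C.
  apply: expr_small; last by rewrite divr_gt0.
  rewrite powR_ge0/= [ltRHS](_ : _ = 1 `^ s); last by rewrite powR1.
  by rewrite gt0_ltr_powR// ?nnegrE// ltW.
have [m + hitm] := hit (maxn M (maxn m0 (maxn m1 (maxn m2 1)))).
rewrite !geq_max => /and5P[mM mm0 mm1 mm2 m_gt0].
pose de := i_ / 4 * h ^+ m.
have hm0 : 0 < h ^+ m by rewrite exprn_gt0.
have de0 : 0 < de by rewrite mulr_gt0// divr_gt0.
have de_h : de < h ^+ m by rewrite /de gtr_pMl//; lra.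
have de1 : de <= 1 by rewrite (le_trans (ltW de_h))// exprn_ile1// ltW.
have hb_m : h ^+ m <= b ^+ m by rewrite lerXn2r// ?nnegrE ltW.
(* wm bounds from below mu(A')^theta for a cube A' as large as a ball of
   radius de *)
pose wm := la * (h `^ t) ^+ m.
have wmE : wm = (c * de `^ s) `^ theta.
  rewrite powRM ?powR_ge0 ?(ltW c0)// -powRrM (_ : s * theta = t); last first.
    by rewrite /theta mulrC divfK ?gt_eqF.
  rewrite /de (@powRM _ (i_ / 4)) ?(ltW hm0)//; last by rewrite divr_ge0 ?(ltW i0).
  by rewrite powR_exprn ?(ltW h_gt0)// /wm /la mulrA.
apply: contrapT => noA'.
have load_cube i : N m i -> Q m i `<=` A -> (wm%:E <= load (Q m i))%E.
  move=> Ni QA; have [n [nM yn hn]] := hitm _ Ni.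
  have [B [cB By Bsub muBge]] := scale (y n) de (introT andP (conj de0 de1)).
  have FQ : cball (y n) de `<=` Q m i.
    apply: subset_trans (ball_sub_cube hQ Ni) => z; rewrite /cball/= => nz.
    move: yn; rewrite !ballEmdist/= => yn.
    apply: (le_lt_trans (metric_triangle _ (y n) _)).
    rewrite (lt_le_trans (ltr_leD yn nz))// -/i_ /de.
    have := ler_wpM2l (ltW i0) hb_m; nra.
  apply: (@le_trans _ _ (load B)); last first.
    by apply: load_le; exact: subset_trans Bsub FQ.
  rewrite leNgt; apply/negP => lB; apply: noA'.
  exists n, (cball (y n) de), B; split.
  - by move: nM; rewrite geq_max => /andP[].
  - exact: closed_cball.
  - exact: subset_trans FQ QA.
  - by apply: cball_sub_ball; exact: lt_le_trans de_h hn.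
  split => //.
    rewrite /light (lt_le_trans lB)// (mu_fin cB) poweR_EFin lee_fin wmE.
    rewrite ge0_ler_powR ?nnegrE ?(ltW theta_gt0) ?fine_ge0//.
      by rewrite mulr_ge0 ?powR_ge0 ?(ltW c0).
    by rewrite -lee_fin -(mu_fin cB).
  apply: (@le_lt_trans _ _ (mu (cball (y n) de))).
    by apply: le_measure; rewrite ?inE//;
      [exact: (cube_family_measurable hQ cB)|exact: measurable_cball].
  apply: (le_lt_trans (muB _ _ (ltW de0))); rewrite lte_fin mulrC -ltr_pdivlMr//.
  apply: le_lt_trans (hm2 _ mm2); rewrite -powR_exprn ?(ltW h_gt0)//.
  by rewrite ge0_ler_powR ?nnegrE ?(ltW s_gt0) ?(ltW de0) ?(ltW hm0) ?(ltW de_h).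
pose J := [set i | [/\ N m i, Q m i `<=` A & forall k, I k -> ~ Q m i `<=` U k]].
have mQ i : J i -> measurable (Q m i : set (borel X)).
  by move=> [Ni _ _]; exact: (cubes_borel hQ Ni).
have mU k : meets A k -> measurable (U k : set (borel X)).
  by move=> [Ik _]; exact: (cube_family_measurable hQ (cubeU Ik)).
have cover : A `<=` \bigcup_(i in J) Q m i `|` \bigcup_(k in meets A) U k.
  move=> z Az; have [i [Ni Qz QA]] := refine _ mm0 _ Az.
  have [[k [Ik QU]]|noU] := pselect (exists k, I k /\ Q m i `<=` U k).
    by right; exists k; [split=> //; exists z; split=> //; exact: QU|exact: QU].
  by left; exists i => //; split=> // k Ik QU; apply: noU; exists k.
have loadJ : (\esum_(i in J) load (Q m i) <= load A)%E.
  apply: esum_disjoint_le => //; last by move=> i [_ QA _]; exact: meets_sub.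
  move=> i j [Ni _ iU] [Nj _ jU] [k [[Ik [z [Uz Qz]]] [_ [z' [Uz' Qz']]]]].
  have sub l : N m l -> (forall k, I k -> ~ Q m l `<=` U k) ->
      U k `&` Q m l !=set0 -> U k `<=` Q m l.
    move=> Nl lU; have := cube_family_nested hQ (cubeU Ik)
      (cube_family_cube Q m_gt0 Nl).
    by move=> [->[]//|//|/(lU _ Ik)].
  apply: contrapT => ij; have := cubes_disjoint hQ Ni Nj ij.
  move=> /seteqP[/(_ z) dis _]; apply: dis; split=> //.
  by apply: sub Uz => //; exists z'.
have muJ : (\esum_(i in J) mu (Q m i) <=
            (K / la * (q / h `^ t) ^+ m)%:E * load A)%E.
  have k0 : 0 <= K / la * (q / h `^ t) ^+ m.
    by rewrite mulr_ge0 ?exprn_ge0 ?divr_ge0 ?ltW.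
  apply: le_trans (lee_wpmul2l _ loadJ); last by rewrite lee_fin.
  rewrite -ge0_esumZl//; last by move=> i; exact: esum_ge0.
  apply: le_esum => i [Ni QA _]; apply: (le_trans (muQ _ _ Ni)).
  apply: (@le_trans _ _ ((K / la * (q / h `^ t) ^+ m)%:E * wm%:E)%E); last first.
    by rewrite lee_wpmul2l ?lee_fin// load_cube.
  rewrite -EFinM lee_fin /wm expr_div_n le_eqVlt; apply/orP; left; apply/eqP.
  have htm : (h `^ t) ^+ m != 0 by rewrite gt_eqF// exprn_gt0.
  by field; rewrite htm gt_eqF.
have : (mu A <= (K / la * (q / h `^ t) ^+ m)%:E * load A +
                (a `^ (1 - theta))%:E * load A)%E.
  apply: (@le_trans _ _ (\esum_(i in J) mu (Q m i) + \esum_(k in meets A) mu (U k))%E);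
    last by rewrite leeD// mu_covered_le.
  have mA := cube_family_measurable hQ cA.
  have mJ : measurable (\bigcup_(i in J) Q m i : set (borel X)).
    exact: bigcup_measurable.
  have mI : measurable (\bigcup_(k in meets A) U k : set (borel X)).
    exact: bigcup_measurable.
  apply: (@le_trans _ _ (mu (\bigcup_(i in J) Q m i `|` \bigcup_(k in meets A) U k))).
    by apply: le_measure; rewrite ?inE//; exact: measurableU.
  apply: (le_trans (measureU2 _ mJ mI)).
  by rewrite leeD//; exact: measure_le_esum.
rewrite loadA_fin (mu_fin cA) -!EFinM -EFinD lee_fin leNgt => /negP; apply.
rewrite -/a -ltrBrDr -/gap.
apply: (@le_lt_trans _ _ (K / la * (q / h `^ t) ^+ m * (v + 1))).
  by rewrite ler_wpM2l ?lerDl// mulr_ge0 ?exprn_ge0 ?divr_ge0 ?ltW.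
have := hm1 _ mm1; rewrite ltr_pdivlMr; last by rewrite mulr_gt0// ltr_wpDl.
move=> lt1; rewrite [ltLHS](_ : _ = (q / h `^ t) ^+ m * (K * (v + 1)) / la).
  by rewrite ltr_pdivrMr.
by ring.
Qed.

(** Iterating [light_step] gives cubes with closed sets in between, so that
    compactness provides a point common to all of them. It lies in infinitely
    many of the balls, hence in some U j, which is then contained in all the
    cubes of the sequence and has measure 0; but cubes have positive
    measure. *)
Lemma limsup_cover_ge A : cube_family N Q A ->
  lim_sup_set (fun n => ball (y n) (r n)) `&` A `<=` \bigcup_(k in I) U k ->
  (mu A `^ theta <= \esum_(k in I) (mu (U k) `^ theta))%E.
Proof.
move=> cA EU; rewrite leNgt; apply/negP => lt_mu.
have lA : light A.
  by apply: le_lt_trans lt_mu; apply: le_esum_set => // k [].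
pose state := {p : set X * nat | cube_family N Q p.1 /\ light p.1}.
pose next (p p' : state) := exists F,
  [/\ ((sval p).2 < (sval p').2)%N, closed F, F `<=` (sval p).1,
      F `<=` ball (y (sval p').2) (r (sval p').2) &
      (sval p').1 `<=` F /\ (mu (sval p').1 < ((sval p).2.+1%:R^-1)%:E)%E].
have ex_next p : {p' | next p p'}.
  apply: cid; case: p => -[B n] /= [cB lB].
  have [|n' [F [B' [nn' cF FB Fb [cB' B'F lB' muB']]]]] :=
    @light_step B n.+1 (n.+1%:R^-1) cB lB; first by rewrite invr_gt0.
  by exists (exist _ (B', n') (conj cB' lB')), F.
have [f [f0 fS]] := dependent_choice ex_next (exist _ (A, 0%N) (conj cA lA)).
pose B k := (sval (f k)).1; pose n k := (sval (f k)).2.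
have cB k : cube_family N Q (B k) by have [] := svalP (f k).
have lB k : light (B k) by have [] := svalP (f k).
have nge k : (k <= n k)%N.
  elim: k => // k IH; have [F [nn _ _ _ _]] := fS k.
  exact: leq_ltn_trans nn.
have BS k : B k.+1 `<=` B k.
  by have [F [_ _ FB _ [BF _]]] := fS k; exact: subset_trans BF FB.
have Bsub k j : (k <= j)%N -> B j `<=` B k.
  elim: j => [|j IH]; first by rewrite leqn0 => /eqP ->.
  rewrite leq_eqVlt ltnS => /predU1P[->//|/IH]; exact: subset_trans.
have /choice[p Bp] k : exists z, B k z.
  apply/set0P/eqP => B0.
  have := cube_family_measure_gt0 hb hQ mu_reg diam_gt0 (cB k).
  by rewrite B0 measure0 ltxx.
have [z [_ zp]] : [set: X] `&` cluster (p @ \oo) !=set0.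
  by apply: hX; exact: filterT.
have Bz k : B k z.
  have [F [_ cF FB _ [BF _]]] := fS k; apply: FB; apply: cF.
  move=> V /(zp F) FV; apply: FV.
  by exists k.+1 => // j /= kj; apply: BF; exact: Bsub kj _ (Bp j).
have [|j Ij Uj] := EU z.
  split; last by have := Bz 0%N; rewrite /B f0.
  move=> k _; exists (n k.+1); first exact: leq_trans (leqnSn _) (nge k.+1).
  have [F [_ _ _ Fb [BF _]]] := fS k; apply: Fb; apply: BF; exact: Bz.
have Uj0 := cube_family_measure_gt0 hb hQ mu_reg diam_gt0 (cubeU Ij).
have UB k : U j `<=` B k by apply: light_sub => //; exists z.
have : (mu (U j) <= 0)%E.
  apply/lee_addgt0Pr => e e0; rewrite add0e.
  have [k hk] : exists k, k.+1%:R^-1 < e.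
    exists (Num.trunc e^-1).
    by rewrite invf_plt ?posrE ?ltr0n// truncnS_gt.
  apply: (@le_trans _ _ (mu (B k.+1))).
    by apply: le_measure; rewrite ?inE//;
      [exact: (cube_family_measurable hQ (cubeU Ij))|
     exact: (cube_family_measurable hQ (cB _))].
  have [F [_ _ _ _ [_ muB]]] := fS k; apply/ltW/(lt_trans muB).
  rewrite lte_fin (le_lt_trans _ hk)// lef_pV2 ?posrE ?ltr0n// ler_nat ltnS.
  exact: nge.
by rewrite leNgt Uj0.
Qed.

End limsup_covers.

(** * The Hausdorff dimension of an Ahlfors regular space *)

Section hausdorff_dimension.
Context {R : realType} {X : pmetricType R}.

Lemma diam_ge0 (A : set X) : (0 <= diam A)%E.
Proof. by apply: ereal_sup_ubound; left. Qed.

Lemma mdist_le_diam (A : set X) y z : A y -> A z ->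
  ((mdist y z)%:E <= diam A)%E.
Proof. by move=> Ay Az; apply: ereal_sup_ubound; right; exists (y, z). Qed.

Lemma diam_le (A : set X) (d : R) : 0 <= d ->
  (forall y, A y -> A `<=` cball y d) -> (diam A <= d%:E)%E.
Proof.
move=> d0 Ad; apply: ge_ereal_sup => _ [->|[[y z] [/= Ay Az] <-]].
  by rewrite lee_fin.
by rewrite lee_fin; exact: Ad Ay _ Az.
Qed.

Variables (b : R) (N : int -> set nat) (Q : int -> nat -> set X).
Variable x : int -> nat -> X.
Context {mu : probability (borel X) R}.
Hypotheses (hb : 0 < b < 1 / 3) (hQ : dyadic_cubes b N Q x).
Variable s : R.
Hypotheses (s_gt0 : 0 < s) (mu_reg : ahlfors_regular s mu).
Hypothesis diam_gt0 : (0 < diam [set: X])%E.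

Let b_gt0 : 0 < b. Proof. by case/andP: hb. Qed.
Let b_lt1 : b < 1. Proof. by case/andP: hb; lra. Qed.

Lemma esum_cubes_le1 (m : nat) : (\esum_(i in N m) mu (Q m i) <= 1)%E.
Proof.
have -> : (\esum_(i in N m) mu (Q m i) = mu (\bigcup_(i in N m) Q m i))%E.
  rewrite measure_bigcup.
  - rewrite nneseries_esum//; congr (esum _ _); apply/seteqP.
    by split => i /=; rewrite in_setE.
  - by move=> i /(cubes_borel hQ).
  - move=> i j Ni Nj [z [Qi Qj]]; apply: contrapT => ij.
    by have /seteqP[/(_ z) h _] := cubes_disjoint hQ Ni Nj ij; exact: h.
apply: probability_le1; apply: bigcup_measurable => i /(cubes_borel hQ); exact.
Qed.

(** For t > s the cubes of generation m form a cover with t-sum at most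
    a constant times (b^t / b^s)^m. *)
Lemma hausdorff_measure_eq0 t : s < t -> hausdorff_measure t [set: X] = 0%E.
Proof.
move=> st; have t0 : 0 < t by exact: lt_trans st.
have pre_ge0 de : (0 <= hausdorff_premeasure t de [set: X])%E.
  apply: le_ereal_inf_tmp => _ [U _ <-].
  by apply: nneseries_ge0 => k _ _; exact: poweR_ge0.
apply/eqP; rewrite eq_le; apply/andP; split; last first.
  by apply: le_trans (pre_ge0 1) _; apply: ereal_sup_ubound; exists 1 => //=.
apply: ge_ereal_sup => _ [de /= de0 <-].
apply/lee_addgt0Pr => e e0; rewrite add0e.
have [c c0 muQ] := cube_measure_ge hb hQ mu_reg diam_gt0.
pose o := 2 / (1 - b).
have o0 : 0 < o by rewrite divr_gt0// subr_gt0.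
have q0 : 0 < b `^ s by exact: powR_gt0.
have [m1 hm1] : exists m1, forall m, (m1 <= m)%N -> b ^+ m < de / o.
  by apply: expr_small; [rewrite (ltW b_gt0)|rewrite divr_gt0].
have [m2 hm2] : exists m2, forall m, (m2 <= m)%N ->
    (b `^ t / b `^ s) ^+ m < e / (o `^ t / c).
  apply: expr_small; last by rewrite !divr_gt0// powR_gt0.
  rewrite divr_ge0 ?powR_ge0//= ltr_pdivrMr// mul1r.
  rewrite -(subrK s t) powRD; last by rewrite subrK (gt_eqF t0).
  rewrite gtr_pMl//.
  rewrite [ltRHS](_ : _ = 1 `^ (t - s)); last by rewrite powR1.
  by rewrite gt0_ltr_powR// ?nnegrE ?subr_gt0// ltW.
pose m := maxn m1 m2.
have bm0 : 0 < b ^+ m by rewrite exprn_gt0.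
have diamQ i : N m i -> (diam (Q m i) <= (o * b ^+ m)%:E)%E.
  move=> Ni; apply: diam_le; first by rewrite mulr_ge0// ltW.
  by move=> y Qy; exact: (cube_sub_cball hQ Ni Qy).
pose U i := if i \in N m then Q m i else set0.
have U0 i : i \notin N m -> diam (U i) = 0%E.
  move=> /negbTE Ni; rewrite /U Ni; apply/eqP; rewrite eq_le diam_ge0 andbT.
  by apply: diam_le.
apply: (@le_trans _ _ (\sum_(0 <= k <oo) (diam (U k)) `^ t)%E).
  apply: ereal_inf_lbound; exists U => //; split.
    move=> y _; have [i Ni Qy] := cube_at hQ m y.
    by exists i => //; rewrite /U mem_set.
  move=> k; have [kN|kN] := boolP (k \in N m); last first.
    by rewrite U0// lee_fin ltW.
  rewrite /U kN; apply: (le_trans (diamQ _ (set_mem kN))).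
  by rewrite lee_fin mulrC -ler_pdivlMr// ltW// hm1// leq_maxl.
rewrite nneseries_esumT; last by move=> k; exact: poweR_ge0.
pose K := o `^ t / c * (b `^ t / b `^ s) ^+ m.
have K0 : 0 <= K by rewrite mulr_ge0 ?exprn_ge0 ?divr_ge0 ?powR_ge0// ltW.
apply: (@le_trans _ _ (\esum_(i in N m) (K%:E * mu (Q m i)))%E).
  rewrite [leRHS]esum_mkcond; apply: le_esum => i _.
  case: ifPn => [iN|iN]; last by rewrite U0// poweR0r// gt_eqF.
  have Ni := set_mem iN; rewrite /U iN.
  apply: (@le_trans _ _ ((o * b ^+ m)%:E `^ t)%E).
    apply: gt0_ler_poweR; rewrite ?(ltW t0)// ?in_itv/= ?diam_ge0 ?leey//.
      by rewrite lee_fin mulr_ge0// ltW.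
    exact: diamQ.
  apply: (@le_trans _ _ (K%:E * (c * (b `^ s) ^+ m)%:E)%E); last first.
    by rewrite lee_wpmul2l ?lee_fin// muQ.
  rewrite poweR_EFin -EFinM lee_fin powRM ?(ltW o0) ?(ltW bm0)//.
  rewrite powR_exprn ?(ltW b_gt0)// /K expr_div_n le_eqVlt.
  apply/orP; left; apply/eqP.
  have qm : (b `^ s) ^+ m != 0 by rewrite gt_eqF// exprn_gt0.
  by field; rewrite qm gt_eqF.
rewrite ge0_esumZl//; apply: (@le_trans _ _ (K%:E * 1)%E).
  by rewrite lee_wpmul2l ?lee_fin// esum_cubes_le1.
rewrite mule1 lee_fin /K mulrC -ler_pdivlMr; last by rewrite divr_gt0// powR_gt0.
by rewrite ltW// hm2// leq_maxr.
Qed.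

(** The mass distribution principle: a set of diameter d has outer measure at
    most a constant times d^s. *)
Lemma hausdorff_measure_gt0 t : 0 < t <= s ->
  (0 < hausdorff_measure t [set: X])%E.
Proof.
move=> /andP[t0 ts]; have [C C0 muB] := ahlfors_upper s_gt0 mu_reg diam_gt0.
apply: (@lt_le_trans _ _ (C^-1)%:E); first by rewrite lte_fin invr_gt0.
apply: (@le_trans _ _ (hausdorff_premeasure t 1 [set: X])); last first.
  by apply: ereal_sup_ubound; exists 1 => //=.
apply: le_ereal_inf_tmp => _ [U [XU U1] <-].
pose d k := fine (diam (U k)).
have dE k : diam (U k) = (d k)%:E.
  rewrite fineK// ge0_fin_numE ?diam_ge0//.
  by rewrite (le_lt_trans (U1 k))// ltry.
have d0 k : 0 <= d k by rewrite fine_ge0// diam_ge0.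
have d1 k : d k <= 1 by rewrite -lee_fin -dE.
have /choice[p Up] k : exists p, U k !=set0 -> U k p.
  by have [[p Up]|U0] := pselect (U k !=set0); [exists p|exists point].
have sumge : (1 <= \esum_(k in [set: nat]) (C%:E * (diam (U k)) `^ t))%E.
  rewrite -(@probability_setT _ _ _ mu).
  apply: (@le_trans _ _ (\esum_(k in [set: nat]) mu (cball (p k) (d k)))%E).
    apply: measure_le_esum => [|k _|]; first exact: measurableT.
      exact: measurable_cball.
    move=> y /XU[k _ Uy]; exists k => //; rewrite /cball/= -lee_fin -dE.
    by apply: mdist_le_diam => //; apply: Up; exists y.
  apply: le_esum => k _; apply: (le_trans (muB _ _ (d0 k))).
  rewrite dE poweR_EFin -EFinM lee_fin ler_pM2l//.
  have := d0 k; rewrite le_eqVlt => /predU1P[<-|dk0].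
    by rewrite !powR0// gt_eqF.
  by apply: ger_powR => //; rewrite dk0 d1.
rewrite nneseries_esumT; last by move=> k; exact: poweR_ge0.
move: sumge; rewrite ge0_esumZl ?(ltW C0)//; last by move=> k; exact: poweR_ge0.
by rewrite -lee_pdivrMl// mule1.
Qed.

Lemma hausdorff_dim_ahlfors : hausdorff_dim [set: X] = s%:E.
Proof.
apply/eqP; rewrite eq_le; apply/andP; split.
  apply/lee_addgt0Pr => e e0; apply: ereal_inf_lbound; exists (s + e) => //=.
  by split; [rewrite addr_gt0|apply: hausdorff_measure_eq0; rewrite ltrDl].
apply: le_ereal_inf_tmp => _ [t /= [t0 Ht] <-]; rewrite lee_fin leNgt.
apply/negP => ts; have := @hausdorff_measure_gt0 t.
by rewrite t0 (ltW ts) Ht ltxx => /(_ isT).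
Qed.

End hausdorff_dimension.

(** * Radii along geometric scales *)

Section elementary.
Context {R : realType}.

Lemma bernoulli_ineq (z : R) n : 0 <= z -> 1 + n%:R * z <= (1 + z) ^+ n.
Proof.
move=> z0; elim: n => [|n IH]; first by rewrite mul0r addr0 expr0.
rewrite exprS; apply: (@le_trans _ _ ((1 + z) * (1 + n%:R * z))).
  rewrite -natr1; have : 0 <= n%:R * z * z by rewrite !mulr_ge0.
  by nra.
by rewrite ler_wpM2l// addr_ge0.
Qed.

(** Multiply by (1 + z)^n, which is at least n z. *)
Lemma one_sub_expr_le (z : R) n : 0 < z <= 1 -> (0 < n)%N ->
  (1 - z) ^+ n <= (n%:R * z)^-1.
Proof.
move=> /andP[z0 z1] n0; have nz : 0 < n%:R * z by rewrite mulr_gt0// ltr0n.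
rewrite -div1r ler_pdivlMr//.
apply: (@le_trans _ _ ((1 - z) ^+ n * (1 + z) ^+ n)).
  rewrite ler_wpM2l ?exprn_ge0 ?subr_ge0//.
  by apply: le_trans (bernoulli_ineq n (ltW z0)); rewrite lerDr.
rewrite -exprMn exprn_ile1//; nra.
Qed.

(** The linear factor is absorbed by any rate strictly between u and 1. *)
Lemma succ_mul_expr_le (u : R) : 0 < u < 1 -> exists K z,
  [/\ 0 < K, 0 < z < 1 & forall m, m.+1%:R * u ^+ m <= K * z ^+ m].
Proof.
move=> /andP[u0 u1]; pose z := (1 + u) / 2; pose e := z / u - 1.
have e0 : 0 < e by rewrite subr_gt0 ltr_pdivlMr// mul1r /z; lra.
exists (1 + e^-1), z; split.
- by rewrite addr_gt0// invr_gt0.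
- by rewrite /z; apply/andP; split; lra.
move=> m; have h := bernoulli_ineq m (ltW e0).
rewrite -ler_pdivlMr ?exprn_gt0// -mulrA -expr_div_n.
have <- : 1 + e = z / u by rewrite /e addrC subrK.
rewrite -natr1 mulrDl mul1r addrC lerD//.
  by apply: le_trans h; rewrite lerDl mulr_ge0// ltW.
rewrite mulrC ler_pdivlMr//; apply: le_trans h; rewrite lerDr.
exact: ler01.
Qed.

(** Condensation along g: on each block from g m to g m.+1 the terms are
    bounded by the first one. If g decreases, the block is empty. *)
Lemma powR_sum_lty (r : R^nat) (t K z : R) (g : nat -> nat) M :
  (forall n, 0 < r n) -> nonincreasing_seq r -> 0 <= t ->
  (forall m, (m <= g m)%N) -> 0 <= K -> 0 <= z < 1 ->
  (forall m, (M <= m)%N -> (g m.+1)%:R * r (g m) `^ t <= K * z ^+ m) ->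
  (\sum_(0 <= n <oo) (r n `^ t)%:E < +oo)%E.
Proof.
move=> r0 dr t0 gge K0 /andP[z0 z1] hg.
pose S k := \sum_(0 <= n < k) r n `^ t.
have Sle i j : (i <= j)%N -> S i <= S j.
  move=> ij; rewrite /S [leRHS](big_cat_nat (n := i))//= lerDl.
  by apply: sumr_ge0 => k _; exact: powR_ge0.
pose C := S (g M) + K * (1 - z)^-1.
have bound k : S (g (M + k)%N) <= S (g M) + K * ((1 - z ^+ k) / (1 - z)).
  elim: k => [|k IH]; first by rewrite addn0 expr0 subrr mul0r mulr0 addr0.
  have [lt|ge] := leqP (g (M + k.+1)) (g (M + k)).
    apply: (le_trans (Sle _ _ lt)); apply: (le_trans IH).
    rewrite lerD2l ler_wpM2l// ler_wpM2r ?invr_ge0 ?subr_ge0 ?(ltW z1)//.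
    by rewrite lerD2l lerN2 exprS ler_piMl ?exprn_ge0// ltW.
  rewrite {1}/S (big_cat_nat (n := g (M + k)%N))//=; last exact: ltnW.
  apply: (@le_trans _ _ (S (g M) + K * ((1 - z ^+ k) / (1 - z)) + K * z ^+ k)).
    rewrite lerD//; apply: (@le_trans _ _ (K * z ^+ (M + k))); last first.
      rewrite ler_wpM2l// exprD ler_piMl ?exprn_ge0// exprn_ile1//.
      exact: ltW.
    apply: le_trans (hg _ (leq_addr _ _)); rewrite -addnS.
    apply: (@le_trans _ _ (\sum_(g (M + k)%N <= i < g (M + k.+1)%N)
                             r (g (M + k)%N) `^ t)).
      rewrite big_nat [leRHS]big_nat; apply: ler_sum => i /andP[gi _].
      by rewrite ge0_ler_powR// ?nnegrE ?(ltW (r0 _))// dr.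
    rewrite big_const_nat iter_addr_0 -[leLHS]mulr_natl ler_wpM2r ?powR_ge0//.
    by rewrite ler_nat leq_subr.
  rewrite -addrA -mulrDr lerD2l ler_wpM2l// exprS.
  rewrite -[X in _ + X](@mulfK _ (1 - z)); last by rewrite gt_eqF// subr_gt0.
  by rewrite -mulrDl ler_pM2r ?invr_gt0 ?subr_gt0//; lra.
apply: (@le_lt_trans _ _ C%:E); last exact: ltry.
apply: lime_le.
  by apply: is_cvg_nneseries => n _ _; rewrite lee_fin powR_ge0.
apply: nearW => k; rewrite sumEFin lee_fin.
apply: (@le_trans _ _ (S (g (M + k)%N))).
  by apply: Sle; apply: leq_trans (gge _); rewrite leq_addl.
apply: (le_trans (bound k)); rewrite lerD2l ler_wpM2l//.
by rewrite ler_piMl ?invr_ge0 ?subr_ge0 ?(ltW z1)// gerBl exprn_ge0.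
Qed.

(** The index in the conclusion is of order m B^m. If the radii at these
    indices were eventually below h^m, the condensed series would be dominated
    by that of m (B h^t)^m, and the series of the (r n)^t would converge,
    although t < s0. *)
Lemma frequently_ge (r : R^nat) (s0 t h B : R) (k : nat) :
  (forall n, 0 < r n) -> nonincreasing_seq r ->
  s0%:E = convergence_exponent r -> 0 < t < s0 -> 0 < h ->
  1 < B -> B * h `^ t < 1 -> (0 < k)%N ->
  forall M, exists2 m, (M <= m)%N &
    h ^+ m <= r (k * m * (Num.trunc (B ^+ m)).+1)%N.
Proof.
move=> r0 dr s0E /andP[t0 ts0] h0 B1 Bh k0 M; apply: contrapT => noM.
pose g m := (k * m * (Num.trunc (B ^+ m)).+1)%N.
have B0 : 0 < B by apply: lt_trans B1.
have u01 : 0 < B * h `^ t < 1 by rewrite Bh mulr_gt0// powR_gt0.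
have [K [z [K0 /andP[z0 z1] hz]]] := succ_mul_expr_le u01.
have : (s0%:E <= t%:E)%E.
  rewrite s0E; apply: ereal_inf_lbound; exists t => //; split; first exact: ltW.
  apply: (@powR_sum_lty r t (k%:R * 2 * B * K) z g M) => //; first exact: ltW.
  - by move=> m; rewrite /g -{1}[m]mul1n -mulnA leq_mul// leq_pmulr.
  - by rewrite !mulr_ge0// ltW.
  - by rewrite z1 ltW.
  move=> m Mm; have rm : r (g m) < h ^+ m.
    by rewrite ltNge; apply/negP => hm; apply: noM; exists m.
  apply: (@le_trans _ _ ((g m.+1)%:R * (h `^ t) ^+ m)).
    rewrite ler_wpM2l// -powR_exprn ?(ltW h0)// ge0_ler_powR ?nnegrE ?(ltW t0)//.
    - exact/ltW.
    - by rewrite exprn_ge0// ltW.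
    - exact/ltW.
  have -> : k%:R * 2 * B * K * z ^+ m = k%:R * 2 * B * (K * z ^+ m) by rewrite mulrA.
  apply: (le_trans _ (ler_wpM2l _ (hz m))); last by rewrite !mulr_ge0// ltW.
  rewrite /g !natrM exprMn.
  have tr : ((Num.trunc (B ^+ m.+1)).+1)%:R <= 2 * B ^+ m.+1 :> R.
    have B1m : 1 <= B ^+ m.+1 by rewrite exprn_ege1// ltW.
    rewrite -natr1 mulr2n mulrDl mul1r lerD//.
    by have /andP[] := truncn_itv (le_trans ler01 B1m).
  have ht0 : 0 <= (h `^ t) ^+ m by rewrite exprn_ge0// powR_ge0.
  apply: (@le_trans _ _ (k%:R * m.+1%:R * (2 * B ^+ m.+1) * (h `^ t) ^+ m)).
    by rewrite ler_wpM2r// ler_wpM2l// mulr_ge0.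
  by rewrite exprS le_eqVlt; apply/orP; left; apply/eqP; ring.
by rewrite lee_fin leNgt ts0.
Qed.

End elementary.

(** * Hitting probabilities of a mixing process *)

Section hitting.
Context {R : realType} {X : pmetricType R} {mu : probability (borel X) R}.
Context {d : measure_display} {Omega : measurableType d}.
Context {P : probability Omega R} {xi : nat -> {RV P >-> borel X}}.
Hypotheses (hstat : stationary xi) (hmix : exponentially_mixing xi).
Hypothesis hlaw : forall n (A : set (borel X)), measurable A ->
  distribution P (xi n) A = mu A.

(** The sampling starts at index g, not 0, so that it only involves the
    variables of index at least g. *)
Definition misses (A : set X) (g j : nat) : set Omega :=
  [set w | forall i, (0 < i <= j)%N -> ~ A (xi (i * g)%N w)].

Lemma tail_sigma_misses (A : set X) g j : measurable (A : set (borel X)) ->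
  tail_sigma xi g (misses A g j).
Proof.
move=> mA; rewrite /tail_sigma; set G := \bigcup_(_ in _) _.
suff : measurable (misses A g j : set (g_sigma_algebraType G)) by [].
have -> : misses A g j =
    \bigcap_(i in [set i | (0 < i <= j)%N]) (xi (i * g)%N @^-1` (~` A)).
  by apply/seteqP; split => w h i hi; exact: h.
apply: bigcap_measurableType => i /= /andP[i0 _]; apply: sub_sigma_algebra.
exists (i * g)%N => /=; first by rewrite leq_pmull.
by exists (~` A); [exact: measurableC|rewrite setTI].
Qed.

Lemma measurable_misses (A : set X) g j : measurable (A : set (borel X)) ->
  measurable (misses A g j).
Proof.
move=> mA.
have -> : misses A g j =
    \bigcap_(i in [set i | (0 < i <= j)%N]) (xi (i * g)%N @^-1` (~` A)).
  by apply/seteqP; split => w h i hi; exact: h.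
apply: bigcap_measurableType => i _.
rewrite -[X in measurable X]setTI; apply: measurable_funP => //.
exact: measurableC.
Qed.

(** Shifting time by g turns the first sampling time into 0, the index that
    the mixing condition singles out. *)
Lemma misses_shift (A : set X) g j : measurable (A : set (borel X)) ->
  P (misses A g j.+1) = P (misses A g j `\` xi 0%N @^-1` A).
Proof.
move=> mA; pose D := [set u : nat -> borel X |
  forall i, (i <= j)%N -> ~ A (u (i * g)%N)].
have mD : path_measurable D.
  rewrite /path_measurable; set G := \bigcup_n _.
  suff : measurable (D : set (g_sigma_algebraType G)) by [].
  have -> : D = \bigcap_(i in [set i | (i <= j)%N])
      ((fun u : nat -> borel X => u (i * g)%N) @^-1` (~` A)).
    by apply/seteqP; split => w h i hi; exact: h.
  apply: bigcap_measurableType => i _; apply: sub_sigma_algebra.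
  exists (i * g)%N => //=.
  by exists (~` A); [exact: measurableC|rewrite setTI].
have := hstat g mD; rewrite /D/=.
have -> : [set w | forall i, (i <= j)%N -> ~ A (xi (i * g + g)%N w)] =
          misses A g j.+1.
  apply/seteqP; split => w /= h i.
    by case: i => // i /= ij; rewrite mulSn addnC; exact: h.
  by move=> ij; have := h i.+1; rewrite mulSn addnC /=; exact.
move=> ->; congr (P _); apply/seteqP; split => w /= h.
  split=> [i /andP[_ ij]|]; first exact: h.
  by have := h 0%N; rewrite mul0n; exact.
move=> i; case: i => [|i] ij; first by rewrite mul0n; exact: h.2.
exact: h.1.
Qed.

(** Given a miss at the later sampling times, which are at least g steps away,
    a hit still has probability at least p minus the mixing error, hence at
    least p / 2. *)
Lemma misses_le : exists c gamma : R, [/\ 0 < c, 0 < gamma < 1 &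
  forall (z : X) (rho p : R) g j, 0 < rho -> (0 < g)%N ->
    (p%:E <= mu (ball z rho))%E -> 0 < p -> c * gamma ^+ g <= p / 2 ->
    (P (misses (ball z rho) g j) <= ((1 - p / 2) ^+ j)%:E)%E].
Proof.
have [c [ga [c0 ga01 mix]]] := hmix; exists c, ga; split=> // z rho p g j rho0 g0.
set A := ball z rho => pA p0 cg.
have mA : measurable (A : set (borel X)) by exact: measurable_mball.
have mX : measurable (xi 0%N @^-1` A).
  by rewrite -[X in measurable X]setTI; apply: measurable_funP.
have PA : P (xi 0%N @^-1` A) = mu A by rewrite -(hlaw 0 mA).
have p1 : p <= 1.
  by rewrite -lee_fin (le_trans pA)// probability_le1.
elim: j => [|j IH].
  rewrite expr0; apply: probability_le1; exact: measurable_misses.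
have mM := measurable_misses g j mA.
rewrite misses_shift// exprS.
have PMfin : P (misses A g j) = (fine (P (misses A g j)))%:E.
  by rewrite fineK// fin_num_measure.
have PIfin : P (misses A g j `&` xi 0%N @^-1` A) =
    (fine (P (misses A g j `&` xi 0%N @^-1` A)))%:E.
  by rewrite fineK// fin_num_measure//; exact: measurableI.
set M := fine _ in PMfin; set I := fine _ in PIfin.
have M0 : 0 <= M by rewrite fine_ge0.
have MIH : M <= (1 - p / 2) ^+ j by rewrite -lee_fin -PMfin.
have key : p / 2 * M <= I.
  have [->|Mneq] := eqVneq M 0; first by rewrite mulr0 fine_ge0.
  have Mgt : 0 < M by rewrite lt_neqAle eq_sym Mneq.
  have := mix g z rho (misses A g j) g0 rho0 (@tail_sigma_misses A g j mA).
  rewrite PMfin lte_fin Mgt => /(_ isT).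
  rewrite /cond_prob -/A PA setIC -/M -/I ler_distl => /andP[h _].
  have pm : p <= fine (mu A).
    by rewrite -lee_fin fineK// fin_num_measure.
  rewrite -ler_pdivlMr//; lra.
have -> : P (misses A g j `\` xi 0%N @^-1` A) = (M - I)%:E.
  rewrite EFinB -PMfin -PIfin; apply: measureD => //.
  by apply: (@le_lt_trans _ _ 1%E); [exact: probability_le1|exact: ltry].
rewrite lee_fin; apply: (@le_trans _ _ ((1 - p / 2) * M)).
  by rewrite mulrBl mul1r; lra.
by rewrite ler_wpM2l//; lra.
Qed.

End hitting.
Arguments misses {R X d Omega P} xi A g j _.

Section hitting_cubes.
Context {R : realType} {X : pmetricType R}.
Variables (b : R) (N : int -> set nat) (Q : int -> nat -> set X).
Variable x : int -> nat -> X.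
Context {mu : probability (borel X) R}.
Hypotheses (hb : 0 < b < 1 / 3) (hQ : dyadic_cubes b N Q x).
Variable s : R.
Hypotheses (s_gt0 : 0 < s) (mu_reg : ahlfors_regular s mu).
Hypothesis diam_gt0 : (0 < diam [set: X])%E.
Context {d : measure_display} {Omega : measurableType d}.
Context {P : probability Omega R} {xi : nat -> {RV P >-> borel X}}.
Hypotheses (hstat : stationary xi) (hmix : exponentially_mixing xi).
Hypothesis hlaw : forall n (A : set (borel X)), measurable A ->
  distribution P (xi n) A = mu A.

Let q := b `^ s.
Let rho m := (1 / 2 - b / (1 - b)) / 2 * b ^+ m.

Let b_gt0 : 0 < b. Proof. by case/andP: hb. Qed.
Let b_lt1 : b < 1. Proof. by case/andP: hb; lra. Qed.
Let q_gt0 : 0 < q. Proof. exact: powR_gt0. Qed.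
Let q_lt1 : q < 1.
Proof.
rewrite [ltRHS](_ : _ = 1 `^ s); last by rewrite powR1.
by rewrite gt0_ltr_powR// ?nnegrE// ltW.
Qed.
Let rho_gt0 m : 0 < rho m.
Proof.
by rewrite mulr_gt0 ?exprn_gt0 ?divr_gt0// inner_radius_gt0.
Qed.

(** Cubes of generation m have measure about q^m, so that B^m nearly
    independent trials with q B > 1 are more than enough to visit all of them.
    For a large, trials at distance a m have mixing errors at most half of the
    lower bound c q^m for the measure of the balls aimed at. A fixed multiple
    j' of B^m trials makes the probability to miss a given cube at most a
    constant times q^(2 m); there are about q^(-m) cubes, so Borel-Cantelli
    applies. *)
Lemma ae_visits_cubes (B : R) : 1 < B * q -> exists2 k, (0 < k)%N &
  {ae P, forall w, exists M, forall m, (M <= m)%N -> forall i, N m i ->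
    exists n, (m <= n <= k * m * (Num.trunc (B ^+ m)).+1)%N /\
      ball (x m i) (rho m) (xi n w)}.
Proof.
move=> Bq.
have B0 : 0 < B by rewrite -(pmulr_lgt0 _ q_gt0) (lt_trans _ Bq).
have [c c0 hc] := inner_ball_measure_ge x hb mu_reg diam_gt0.
have [ka ka0 hka] := cube_measure_ge hb hQ mu_reg diam_gt0.
have [cc [ga [cc0 /andP[ga0 ga1] miss]]] := misses_le hstat hmix hlaw.
have [a0 ha0] : exists a0, forall a, (a0 <= a)%N ->
    ga ^+ a < q * Num.min 1 (c / 2 / cc).
  apply: expr_small; first by rewrite ga1 ltW.
  by rewrite mulr_gt0// lt_min ltr01 !divr_gt0.
pose a := a0.+1.
have [j hj] : exists j, forall n, (j <= n)%N -> (B * q)^-1 ^+ n < q ^+ 2.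
  apply: expr_small; last by rewrite exprn_gt0.
  have Bq0 : 0 < B * q by exact: lt_trans ltr01 Bq.
  by rewrite invf_lt1// Bq andbT invr_ge0 ltW.
pose j' := j.+1; pose L m := (Num.trunc (B ^+ m)).+1.
pose missed m i := misses xi (ball (x m%:Z i) (rho m)) (a * m) (j' * L m).
pose C := (2 / c) ^+ j' / ka.
have C0 : 0 <= C by rewrite divr_ge0 ?exprn_ge0 ?divr_ge0 ?ltW.
have missed_le m i : (0 < m)%N -> N m i ->
    (P (missed m i) <= (C * q ^+ m)%:E * mu (Q m i))%E.
  move=> m0 Ni; pose p := c * q ^+ m.
  have qm0 : 0 < q ^+ m by rewrite exprn_gt0.
  have p0 : 0 < p by rewrite mulr_gt0.
  have p_mu : (p%:E <= mu (ball (x m i) (rho m)))%E by exact: hc.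
  have p1 : p <= 1.
    by rewrite -lee_fin (le_trans p_mu)// probability_le1//; exact: measurable_mball.
  have small : cc * ga ^+ (a * m) <= p / 2.
    rewrite mulrC -ler_pdivlMr// exprM.
    apply: (@le_trans _ _ ((q * Num.min 1 (c / 2 / cc)) ^+ m)).
      rewrite lerXn2r// ?nnegrE; last exact/ltW/ha0.
        by rewrite exprn_ge0// ltW.
      by rewrite mulr_ge0 ?ltW// lt_min ltr01 !divr_gt0.
    set e := Num.min _ _; have e0 : 0 < e by rewrite lt_min ltr01 !divr_gt0.
    have e1 : e <= 1 by rewrite ge_min lexx.
    rewrite exprMn (_ : p / 2 / cc = q ^+ m * (c / 2 / cc)); last by rewrite /p; ring.
    rewrite ler_pM2l//; apply: (@le_trans _ _ e); last by rewrite ge_min lexx orbT.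
    by rewrite -(prednK m0) exprS ler_piMr ?(ltW e0)// exprn_ile1// ltW.
  have am0 : (0 < a * m)%N by rewrite muln_gt0.
  apply: (le_trans (miss _ _ _ _ _ (rho_gt0 m) am0 p_mu p0 small)).
  have L_ge : B ^+ m <= (L m)%:R by rewrite ltW// truncnS_gt.
  have Bm0 : 0 < B ^+ m by rewrite exprn_gt0.
  apply: (@le_trans _ _ (C * q ^+ m * (ka * q ^+ m))%:E); last first.
    rewrite EFinM; apply: lee_wpmul2l; last exact: hka.
    by rewrite lee_fin mulr_ge0// ltW.
  have -> : C * q ^+ m * (ka * q ^+ m) = (2 / c) ^+ j' * (q ^+ 2) ^+ m.
    have -> : (q ^+ 2) ^+ m = q ^+ m * q ^+ m by rewrite -exprM mulnC exprM expr2.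
    rewrite /C; set u := (2 / c) ^+ j'; set z := q ^+ m.
    by field; rewrite gt_eqF.
  rewrite lee_fin mulnC exprM.
  have p2 : 0 < p / 2 <= 1 by apply/andP; split; lra.
  apply: (@le_trans _ _ ((2 / c * (B * q)^-1 ^+ m) ^+ j')).
    rewrite lerXn2r// ?nnegrE.
    - by rewrite exprn_ge0// subr_ge0; case/andP: p2.
    - by rewrite mulr_ge0 ?divr_ge0 ?exprn_ge0 ?invr_ge0 ?mulr_ge0 ?ltW.
    apply: (le_trans (one_sub_expr_le p2 (ltn0Sn _))).
    rewrite (_ : 2 / c * (B * q)^-1 ^+ m = (B ^+ m * (p / 2))^-1).
      by rewrite lef_pV2 ?posrE ?mulr_gt0 ?ltr0n// ler_pM2r//; case/andP: p2.
    rewrite exprVn exprMn /p; field.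
    by rewrite !gt_eqF.
  rewrite exprMn ler_wpM2l ?exprn_ge0 ?divr_ge0 ?(ltW c0)//.
  rewrite [leLHS]exprAC; apply: lerXn2r; last exact/ltW/hj.
    by rewrite nnegrE exprn_ge0// invr_ge0 mulr_ge0// ltW.
  by rewrite nnegrE exprn_ge0// ltW.
(* generation 0 is left out, as the distance a m of the trials would be 0 *)
pose F m := \bigcup_(i in N m.+1) missed m.+1 i.
have mmissed m i : measurable (missed m i).
  by apply: measurable_misses; exact: measurable_mball.
have mF m : measurable (F m) by apply: bigcup_measurable => i _.
have PF m : (P (F m) <= C%:E * (q ^+ m)%:E)%E.
  apply: (@le_trans _ _ (\esum_(i in N m.+1) P (missed m.+1 i))%E).
    by apply: measure_le_esum => // i _.
  apply: (@le_trans _ _ (\esum_(i in N m.+1) ((C * q ^+ m.+1)%:E * mu (Q m.+1 i)))%E).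
    by apply: le_esum => i Ni; exact: missed_le.
  have Cq0 : 0 <= C * q ^+ m.+1 by rewrite mulr_ge0// exprn_ge0// ltW.
  rewrite ge0_esumZl//; apply: (@le_trans _ _ ((C * q ^+ m.+1)%:E * 1)%E).
    by rewrite lee_wpmul2l ?lee_fin//; exact: (esum_cubes_le1 hQ).
  rewrite mule1 -EFinM lee_fin ler_wpM2l// exprS ler_piMl ?exprn_ge0 ?(ltW q_gt0)//.
  exact: ltW.
have limF0 : P (lim_sup_set F) = 0%E.
  apply: lim_sup_set_cvg0 => //.
  apply: (@le_lt_trans _ _ (\sum_(0 <= m <oo) (C%:E * (q ^+ m)%:E))%E).
    by apply: lee_nneseries => // m _; exact: PF.
  rewrite nneseriesZl; last by move=> m _; rewrite lee_fin exprn_ge0// ltW.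
  rewrite lte_mul_pinfty ?lee_fin ?ltry//.
  by apply: nneseries_geometric_lty; rewrite q_lt1 ltW.
exists (j' * a)%N => //.
exists (lim_sup_set F); split => //.
  apply: bigcapT_measurable => n; exact: bigcup_measurable.
apply: subsetCl => w /= nw.
have [n0 hn0] : exists n0, forall m, (n0 <= m)%N -> ~ F m w.
  apply: contrapT => noM; apply: nw => n _; apply: contrapT => nF.
  by apply: noM; exists n => m nm Fm; apply: nF; exists m.
exists n0.+1 => m n0m i Ni.
have m0 : (0 < m)%N by apply: leq_ltn_trans n0m.
have nmi : ~ missed m i w.
  move=> mw; apply: (hn0 m.-1); first by rewrite -ltnS prednK.
  by exists i; rewrite prednK.
apply: contrapT => noN; apply: nmi => k /andP[k0 kj] bk; apply: noN.
exists (k * (a * m))%N; split => //; apply/andP; split.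
  by rewrite mulnA leq_pmull// muln_gt0 k0.
rewrite -/(L m) (_ : (j' * a * m * L m = (j' * L m) * (a * m))%N).
  by rewrite leq_mul2r kj orbT.
by rewrite -!mulnA; congr muln; rewrite mulnA mulnC.
Qed.

Lemma powR_lt_expo (u v : R) : u < v -> b `^ v < b `^ u.
Proof.
move=> uv; rewrite -(subrK u v) powRD; last by rewrite (gt_eqF b_gt0) implybT.
rewrite gtr_pMl ?powR_gt0//.
rewrite [ltRHS](_ : _ = 1 `^ (v - u)); last by rewrite powR1.
by rewrite gt0_ltr_powR// ?nnegrE ?subr_gt0// ltW.
Qed.

(** With h = b^v the two requirements, b^s < h^t for the covering argument and
    h^t2 < b^s for the radii along the B^m with B > b^(-s), leave the window
    s / t2 < v < s / t. *)
Lemma ae_hits_cubes (r : R^nat) (s0 t : R) :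
  (forall n, 0 < r n) -> nonincreasing_seq r ->
  s0%:E = convergence_exponent r -> 0 < t < s0 -> s0 <= s ->
  exists h, [/\ 0 < h, h <= b, b `^ s < h `^ t &
    {ae P, forall w, hits_cubes b N x (fun n => xi n w) r h}].
Proof.
move=> r0 dr s0E /andP[t0 ts0] s0s.
pose t3 := (2 * t + s0) / 3; pose t2 := (t + 2 * s0) / 3; pose v := s / t3.
have [tt3 t32 t2s0] : [/\ t < t3, t3 < t2 & t2 < s0].
  by rewrite /t3 /t2; split; lra.
have t30 : 0 < t3 by lra.
pose h := b `^ v; have h0 : 0 < h by exact: powR_gt0.
have v1 : 1 <= v by rewrite ler_pdivlMr//; lra.
have hq t' : h `^ t' = b `^ (v * t') by rewrite powRrM.
have h_t : q < h `^ t.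
  by rewrite hq; apply: powR_lt_expo; rewrite /v mulrAC ltr_pdivrMr// ltr_pM2l.
have h_t2 : h `^ t2 < q.
  by rewrite hq; apply: powR_lt_expo; rewrite /v mulrAC ltr_pdivlMr// ltr_pM2l.
have ht20 : 0 < h `^ t2 by exact: powR_gt0.
pose B := 2 / (h `^ t2 + q).
have den0 : 0 < h `^ t2 + q by rewrite addr_gt0.
have Bq : 1 < B * q by rewrite /B mulrAC ltr_pdivlMr//; lra.
have Bh : B * h `^ t2 < 1 by rewrite /B mulrAC ltr_pdivrMr//; lra.
have B1 : 1 < B by rewrite ltr_pdivlMr//; have := q_lt1; lra.
exists h; split => //.
  by rewrite -[leRHS]powRr1 ?(ltW b_gt0)//; apply: ger_powR => //; rewrite b_gt0 ltW.
have [k k0 aek] := ae_visits_cubes Bq.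
apply: filterS aek => w [M0 hM0] M.
have t2s : 0 < t2 < s0 by apply/andP; split; lra.
have [m + rm] := frequently_ge r0 dr s0E t2s h0 B1 Bh k0 (maxn M M0).
rewrite geq_max => /andP[Mm M0m]; exists m => // i Ni.
have [n [/andP[mn nk] bn]] := hM0 m M0m i Ni.
exists n; split => //; first exact: leq_trans mn.
by apply: (le_trans rm); exact: dr.
Qed.

End hitting_cubes.

(** * Large intersections *)

Section limsup_large_intersection.
Context {R : realType} {X : pmetricType R}.

Lemma Gdelta_limsup_balls (y : nat -> X) (r : R^nat) :
  Gdelta (lim_sup_set (fun n => ball (y n) (r n))).
Proof.
exists (fun n => \bigcup_(j >= n) ball (y j) (r j)) => //.
move=> n; apply: bigcup_open => j _; exact: open_mball.
Qed.

Lemma net_content_le (mu : {measure set (borel X) -> \bar R})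
    (QQ : set (set X)) (t : R) (A B : set X) : A `<=` B ->
  (net_content mu QQ t A <= net_content mu QQ t B)%E.
Proof.
move=> AB; apply: le_ereal_inf => _ [I [U [QU BU ->]]].
by exists I, U; split=> //; exact: subset_trans BU.
Qed.

Lemma net_content_cube_le (mu : {measure set (borel X) -> \bar R})
    (QQ : set (set X)) (t : R) (A : set X) : QQ A ->
  (net_content mu QQ t A <=
   mu A `^ (t / fine (hausdorff_dim [set: X])))%E.
Proof.
move=> QA; apply: ereal_inf_lbound; exists [set 0%N], (fun=> A); split=> //.
- by move=> z Az; exists 0%N.
- by rewrite esum_set1// poweR_ge0.
Qed.

(** On a one-point space regularity is void and the dimension is 0 instead
    of s; there the limsup set is everything. *)
Lemma limsup_full_large_intersection (mu : {measure set (borel X) -> \bar R})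
    (QQ : set (set X)) (s : R) (y : nat -> X) (r : R^nat) :
  (forall n, 0 < r n) -> diam [set: X] = 0%E ->
  large_intersection mu QQ s (lim_sup_set (fun n => ball (y n) (r n))).
Proof.
move=> r0 diam0; split; first exact: Gdelta_limsup_balls.
have -> : lim_sup_set (fun n => ball (y n) (r n)) = [set: X].
  apply/seteqP; split=> // z _ n _; exists n => //=; rewrite ballEmdist/=.
  apply: le_lt_trans (r0 n).
  by have := @mdist_le_diam _ _ [set: X] (y n) z I I; rewrite diam0 lee_fin.
by move=> t _ A _; rewrite setTI.
Qed.

End limsup_large_intersection.

Theorem theorem4p3 (R : realType) (X : pmetricType R)
    (mu : probability (borel X) R) (s : R)
    (b : R) (N : int -> set nat) (Q : int -> nat -> set X)
    (x : int -> nat -> X)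
    (d : measure_display) (Omega : measurableType d)
    (P : probability Omega R) (xi : nat -> {RV P >-> borel X})
    (r : R^nat) (s0 : R)
    (hs : 0 < s)
    (hX : compact [set: X])
    (hmu : ahlfors_regular s mu)
    (hb : 0 < b < 1 / 3)
    (hQ : dyadic_cubes b N Q x)
    (hstat : stationary xi)
    (hlaw : forall n (A : set (borel X)), measurable A ->
              distribution P (xi n) A = mu A)
    (hmix : exponentially_mixing xi)
    (hr_gt0 : forall n, 0 < r n)
    (hr_decr : nonincreasing_seq r)
    (hr_cvg : r @ \oo --> (0 : R))
    (hs0 : s0%:E = convergence_exponent r)
    (hs0_bound : 0 < s0 <= s) :
  {ae P, forall w : Omega,
     large_intersection mu (cube_family N Q) s0
       (lim_sup_set (fun n => ball (xi n w : X) (r n)))}.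
Proof.
have [diam0|diam_gt0] := leP (diam [set: X]) 0%E.
  apply: aeW => w; apply: limsup_full_large_intersection => //.
  by apply/eqP; rewrite eq_le diam0 diam_ge0.
move: hs0_bound => /andP[s0_gt0 s0_les].
pose t (k : nat) := s0 * (1 - k.+2%:R^-1).
have t_itv k : 0 < t k < s0.
  have k0 : 0 < k.+2%:R^-1 :> R by rewrite invr_gt0 ltr0n.
  have k1 : k.+2%:R^-1 < 1 :> R by rewrite invf_lt1 ?ltr0n// ltr1n.
  by rewrite mulr_gt0 ?subr_gt0//= gtr_pMr// gtrBl.
have /choice[h hP] k := ae_hits_cubes hb hQ hs hmu diam_gt0 hstat hmix hlaw
  hr_gt0 hr_decr hs0 (t_itv k) s0_les.
have : {ae P, forall w, forall k, hits_cubes b N x (fun n => xi n w) r (h k)}.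
  by apply: ae_foralln => k; have [] := hP k.
apply: filterS => w hit; split; first exact: Gdelta_limsup_balls.
move=> t' /andP[t'_gt0 t'_lt] A cA.
have [k t'k] : exists k, t' <= t k.
  set e := 1 - t' / s0; have e0 : 0 < e by rewrite subr_gt0 ltr_pdivrMr// mul1r.
  exists (Num.trunc e^-1); set k := Num.trunc _.
  have ke : k.+2%:R^-1 <= e.
    rewrite invf_ple ?posrE ?ltr0n//; apply: (le_trans (ltW (truncnS_gt _))).
    by rewrite ler_nat.
  rewrite /t [leRHS]mulrC -ler_pdivrMr//.
  by rewrite lerBrDr addrC -lerBrDr.
have [h_gt0 h_leb q_lt _] := hP k; have /andP[b_gt0 b_lt] := hb.
apply/eqP; rewrite eq_le net_content_le/=; last exact: subIsetr.
apply: (le_trans (net_content_cube_le mu t' cA)).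
apply: le_ereal_inf_tmp => _ [I [U [cU cover ->]]].
rewrite (hausdorff_dim_ahlfors hb hQ hs hmu diam_gt0)/=.
apply: (limsup_cover_ge hb hQ hs hmu diam_gt0 hX h_gt0 h_leb _ t'_gt0 _
  (hit k) cU cA cover).
- apply: (lt_le_trans q_lt); apply: ger_powR => //.
  by rewrite h_gt0 (le_trans h_leb)//; lra.
- exact: lt_le_trans t'_lt s0_les.
Qed.
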